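(* Let $\mathcal{X}$ be an uncountable Polish space and let $\rho:\mathbb{B}(\mathcal{X})\times\mathcal{P}(\mathcal{X})\to\mathbb{R}$ be a risk form that is normalized, translation equivariant, comonotonically convex, and consistent with the increasing convex order. Then a uniquely defined closed convex set $$\mathcal{D}_\rho\subseteq\big\{\mu\in\mathcal{M}:\ \mu(0,\cdot]\ \text{is nondecreasing and convex on }(0,1],\ \mu(0,1]=1\big\}$$ exists, such that for all $[Z,P]\in\mathbb{B}(\mathcal{X})\times\mathcal{P}(\mathcal{X})$ $$\rho[Z,P]=\sup_{\mu\in\mathcal{D}_\rho}\bigg\{\int_0^1\varPhi[Z,P](p)\,\mu(dp)-\rho^*(\mu)\bigg\}.$$ If, additionally, $\rho$ is positively homogeneous, then $\rho^*(\mu)=0$ for all $\mu\in\mathcal{D}_\rho$.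
   Context: $\mathcal{X}$ is equipped with its Borel $\sigma$-algebra; $\mathcal{P}(\mathcal{X})$ is the set of Borel probability measures on $\mathcal{X}$; $\mathbb{B}(\mathcal{X})$ is the space of all real-valued bounded Borel measurable functions on $\mathcal{X}$; $\mathbf{1}$ is the constant function $1$; $[a]_+=\max(0,a)$. A risk form is a measurable functional $\rho:\mathbb{B}(\mathcal{X})\times\mathcal{P}(\mathcal{X})\to\mathbb{R}$. It is: - normalized if $\rho[0,P]=0$ for all $P$; - translation equivariant if $\rho[a\mathbf{1}+V,P]=a+\rho[V,P]$ for all $V\in\mathbb{B}(\mathcal{X})$, $a\in\mathbb{R}$, $P\in\mathcal{P}(\mathcal{X})$; - positively homogeneous if $\rho[\beta V,P]=\beta\rho[V,P]$ for all $V\in\mathbb{B}(\mathcal{X})$, $\beta\in\mathbb{R}_+$, $P\in\mathcal{P}(\mathcal{X})$; - comonotonically convex if $\rho[\lambda Z+(1-\lambda)V,P]\le\lambda\rho[Z,P]+(1-\lambda)\rho[V,P]$ for all comonotonic $Z,V\in\mathbb{B}(\mathcal{X})$, all $P\in\mathcal{P}(\mathcal{X})$, and all $\lambda\in[0,1]$, where $Z,V$ are comonotonic if $(Z(x')-Z(x))(V(x')-V(x))\ge0$ for all $x,x'\in\mathcal{X}$; - consistent with the increasing convex order if $[Z,P]\preceq[Z',P']$ implies $\rho[Z,P]\le\rho[Z',P']$, where $[Z,P]\preceq[Z',P']$ means that $\int_{\mathcal{X}}[Z(x)-\eta]_+\,P(dx)\le\int_{\mathcal{X}}[Z'(x)-\eta]_+\,P'(dx)$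 for all $\eta\in\mathbb{R}$ (here both the functions and the measures may differ). The quantile function of $[Z,P]$ is $\varPhi[Z,P](p)=\inf\{\eta\in\mathbb{R}:P[Z\le\eta]\ge p\}$, $p\in(0,1]$. $\mathcal{M}$ is the set of countably additive finite measures on $(0,1]$. The conjugate functional $\rho^*:\mathcal{M}\to\mathbb{R}\cup\{+\infty\}$ is $$\rho^*(\mu)=\sup_{[Z,P]\in\mathbb{B}(\mathcal{X})\times\mathcal{P}(\mathcal{X})}\bigg\{\int_0^1\varPhi[Z,P](p)\,\mu(dp)-\rho[Z,P]\bigg\}.$$
   Formalization: ''Uniquely defined'' is false among all closed convex representing sets (for AVaR, its distortion alone and the segment to Lebesgue measure both work); D_rho is instead the smallest closed convex set (weak topology) containing the admissible mu with rho*(mu) finite. *)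

(* Defs.v *)
From HB Require Import structures.
From mathcomp Require Import all_boot all_order all_algebra.
From mathcomp Require Import all_classical all_reals all_analysis.

Set Implicit Arguments.
Unset Strict Implicit.
Unset Printing Implicit Defensive.

Import Order.TTheory GRing.Theory Num.Theory.
Import numFieldNormedType.Exports.

Local Open Scope classical_set_scope.
Local Open Scope ring_scope.

Definition is_metric (R : realType) (X : Type) (d : X -> X -> R) : Prop :=
  [/\ forall x y, d x y = 0 <-> x = y,
      forall x y, d x y = d y x
    & forall x y z, d x z <= d x y + d y z].

Definition generates_topology (R : realType) (X : topologicalType)
    (d : X -> X -> R) : Prop :=
  forall (x : X) (U : set X),
    nbhs x U <-> exists2 e : R, 0 < e & [set y | d x y < e] `<=` U.

Definition complete_metric (R : realType) (X : topologicalType)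
    (d : X -> X -> R) : Prop :=
  forall u : nat -> X,
    (forall e : R, 0 < e -> exists N : nat, forall m n : nat,
      (N <= m)%N -> (N <= n)%N -> d (u m) (u n) < e) ->
    exists l : X, u @ \oo --> l.

Definition polish (R : realType) (X : topologicalType) : Prop :=
  (exists2 S : set X, countable S & dense S) /\
  exists d : X -> X -> R,
    [/\ is_metric d, generates_topology d & complete_metric d].

(* Borel sigma-algebra; the library asks the carrier to be pointed, which only
   excludes the empty space. *)
Definition borel (X : ptopologicalType) := g_sigma_algebraType (@open X).

Notation prob X R := (probability (borel X) R).

(* The space B(X), as a subset of all functions.  A functional on B(X) x P(X)
   is represented by a total function on (X -> R) * P(X) whose values outside
   B(X) are never used. *)
Definition bmeas (R : realType) (X : ptopologicalType) : set (X -> R) :=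
  [set f | measurable_fun [set: borel X] (f : borel X -> R) /\ bounded_fun f].
Arguments bmeas : clear implicits.

Section risk_forms.
Context {R : realType} {X : ptopologicalType}.
Implicit Types (rho : (X -> R) -> prob X R -> R).

(* The sigma-algebra F on B(X) x P(X) is kept as a parameter.  Fixing the Borel
   sets of the supremum norm on B(X) and of weak convergence on P(X) would make
   the axioms below contradictory: they force rho[1_A, delta_x] = 1_A(x), while
   a Borel set of the product has sections of bounded Borel class. *)
Definition measurable_form (F : set_system ((X -> R) * prob X R)) rho : Prop :=
  forall Y : set R, measurable Y ->
    F ((bmeas R X `*` setT) `&` [set ZP | Y (rho ZP.1 ZP.2)]).

Definition normalized rho : Prop :=
  forall P, rho (fun=> 0) P = 0.

Definition translation_equivariant rho : Prop :=
  forall V (a : R) P, bmeas R X V ->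
    rho (fun x => a + V x) P = a + rho V P.

Definition positively_homogeneous rho : Prop :=
  forall V (b : R) P, bmeas R X V -> 0 <= b ->
    rho (fun x => b * V x) P = b * rho V P.

Definition comonotonic (Z V : X -> R) : Prop :=
  forall x x' : X, 0 <= (Z x' - Z x) * (V x' - V x).

Definition comonotonically_convex rho : Prop :=
  forall Z V P (l : R), bmeas R X Z -> bmeas R X V -> comonotonic Z V ->
    0 <= l <= 1 ->
    rho (fun x => l * Z x + (1 - l) * V x) P <= l * rho Z P + (1 - l) * rho V P.

Definition icx (Z : X -> R) (P : prob X R) (Z' : X -> R) (P' : prob X R) : Prop :=
  forall eta : R,
    (\int[P]_x (Num.max 0 (Z x - eta))%:E
       <= \int[P']_x (Num.max 0 (Z' x - eta))%:E)%E.

Definition icx_consistent rho : Prop :=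
  forall Z P Z' P', bmeas R X Z -> bmeas R X Z' -> icx Z P Z' P' ->
    rho Z P <= rho Z' P'.

Definition quantile (Z : X -> R) (P : prob X R) (p : R) : R :=
  inf [set eta : R | (p%:E <= P [set x | (Z x <= eta)%R])%E].

End risk_forms.

(* The set M: a finite measure on (0,1] is identified with the finite Borel
   measure on the line, concentrated on (0,1], that extends it by 0. *)
Definition meas01 (R : realType) : Type :=
  {mu : {finite_measure set (measurableTypeR R) -> \bar R} |
    mu (~` `]0%R, 1%R]%classic) = 0%E}.

HB.instance Definition _ (R : realType) := gen_eqMixin (meas01 R).
HB.instance Definition _ (R : realType) := gen_choiceMixin (meas01 R).

Definition mval (R : realType) (mu : meas01 R) :
  {finite_measure set (measurableTypeR R) -> \bar R} := sval mu.
Coercion mval : meas01 >-> FiniteMeasure.type.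

Definition bcont01 (R : realType) : Type :=
  {f : R -> R | {within `]0%R, 1%R], continuous f} /\
                [bounded f p | p in `]0%R, 1%R]]}.

Definition bcont01_pairing (R : realType) (mu : meas01 R) :
    {ptws bcont01 R -> R} :=
  fun f => Rintegral mu `]0%R, 1%R] (sval f).

(* M carries the topology of weak convergence, that is, the coarsest one making
   mu |-> \int f dmu continuous for all bounded continuous f on (0,1]. *)
HB.instance Definition _ (R : realType) :=
  Topological.copy (meas01 R) (initial_topology (@bcont01_pairing R)).

Section conjugate.
Context {R : realType} {X : ptopologicalType}.

Definition convex_meas (D : set (meas01 R)) : Prop :=
  forall (mu nu kappa : meas01 R) (t : R), D mu -> D nu -> 0 <= t <= 1 ->
    (forall A : set (measurableTypeR R), measurable A ->
       kappa A = (t%:E * mu A + (1 - t)%:E * nu A)%E) ->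
    D kappa.

Definition cdf01 (mu : meas01 R) (p : R) : R := fine (mu `]0%R, p]%classic).

Definition distortions : set (meas01 R) :=
  [set mu | [/\ {in `]0%R, 1%R] &, {homo cdf01 mu : p q / p <= q}},
                convex_function (`]0%R, 1%R]%classic : set R) (cdf01 mu)
              & mu `]0%R, 1%R]%classic = 1%E]].

Definition quantile_integral (Z : X -> R) (P : prob X R) (mu : meas01 R) :
    \bar R :=
  (\int[mu]_(p in `]0%R, 1%R]) (quantile Z P p)%:E)%E.

Definition conj_form (rho : (X -> R) -> prob X R -> R) (mu : meas01 R) :
    \bar R :=
  ereal_sup [set (quantile_integral ZP.1 ZP.2 mu - (rho ZP.1 ZP.2)%:E)%E
            | ZP in bmeas R X `*` setT].

Definition represents (rho : (X -> R) -> prob X R -> R)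
    (D : set (meas01 R)) : Prop :=
  forall Z P, bmeas R X Z ->
    (rho Z P)%:E =
      ereal_sup [set (quantile_integral Z P mu - conj_form rho mu)%E
                | mu in D].

(* The effective domain of the conjugate among the measures with convex
   distribution function.  Closedness, convexity and the representation do not
   determine the representing set (for the Average Value at Risk the singleton
   of its distortion and the segment joining it to the Lebesgue measure both
   qualify), so the uniquely defined set is the smallest closed convex set
   carrying this domain.  The closure is needed: the domain itself is not
   closed for, e.g., the entropic risk measure. *)
Definition conj_domain (rho : (X -> R) -> prob X R -> R) : set (meas01 R) :=
  distortions `&` [set mu | (conj_form rho mu < +oo)%E].

Definition least_closed_convex (A D : set (meas01 R)) : Prop :=
  A `<=` D /\
  forall C : set (meas01 R), closed C -> convex_meas C -> A `<=` C -> D `<=` C.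

End conjugate.

(* Main.v *)
Require Import Defs.
From HB Require Import structures.
From mathcomp Require Import all_boot all_order all_algebra.
From mathcomp Require Import all_classical all_reals all_analysis.
From mathcomp Require Import measurable_realfun ring lra.

(** The set [D] is the intersection of all closed convex sets of measures that
    contain [conj_domain rho]; by minimality no other set has the stated
    properties.  It consists of distortions because these form a closed convex
    set ([closed_distortions], [convex_distortions]): convexity of a
    distribution function can be tested with integrals of piecewise linear
    functions.

    In the representation, the inequality >= is the definition of the
    conjugate.  For <=, the supremum is attained in [conj_domain rho]
    ([supporting_distortion]).  An uncountable Polish space contains a Cantor
    set, hence carries a probability Q and a function U that is uniform on
    (0,1] under Q ([polish_uniform]).  By consistency with the increasing convex
    order, rho[Z,P] depends only on the quantile function of [Z,P], and equals
    r(phi) = rho[phi o U, Q] when phi is that quantile function.  For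
    nondecreasing phi the functions phi o U are pairwise comonotonic, so r is
    convex on the cone of bounded nondecreasing functions on (0,1].  On this
    cone the increasing convex order is the pointwise order of the tail
    integrals A_phi(a) = \int_a^1 phi, so r is a monotone convex function of
    A_phi, and the Hahn-Banach theorem yields a positive linear functional L
    with r(psi) - r(phi) >= L(A_psi) - L(A_phi) for all psi
    ([supporting_functional]).

    The functional L is integration against a distortion.  For the indicator of
    (q,1] the tail integral at a is 1 - max(a,q), which is concave in q; since L
    is positive, F(q) = 1 - L(a |-> 1 - max(a,q)) is a convex distribution
    function.  It is right-continuous, with a possible jump at 1, and quantile
    functions are uniform limits of staircases, so the Lebesgue-Stieltjes
    measure of F represents L on them ([measure_of_tail_functional]).

    If rho is positively homogeneous, the conjugate only takes the values 0 and
    +oo on distortions.  The distortions where it is at most 0 form a convex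
    set, which is closed because the integral of a left-continuous
    nondecreasing function is the supremum of the integrals of the Lipschitz
    functions below it ([closed_integral_le]).  This set therefore contains
    [D]. *)

Set Implicit Arguments.
Unset Strict Implicit.
Unset Printing Implicit Defensive.

Import Order.TTheory GRing.Theory Num.Theory.
Import numFieldNormedType.Exports.
Local Open Scope classical_set_scope.
Local Open Scope ring_scope.

(** * Sublinear functionals and the Hahn-Banach theorem *)

Section sublinear.
Context {R : realType} {V : lmodType R}.
Variable B : set V.
Hypothesis B0 : B 0.
Hypothesis BD : forall x y, B x -> B y -> B (x + y).
Hypothesis BZ : forall (a : R) x, B x -> B (a *: x).

(** Sublinearity on the subspace [B].  Homogeneity is only required as an
    inequality; the converse inequality follows by scaling back. *)
Definition sublinear_on (q : V -> R) : Prop :=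
  (forall x y, B x -> B y -> q (x + y) <= q x + q y) /\
  (forall (t : R) x, 0 < t -> B x -> q (t *: x) <= t * q x).

Let BN x : B x -> B (- x).
Proof. by move=> Bx; rewrite -scaleN1r; exact: BZ. Qed.

Lemma sublinear_on0 q : sublinear_on q -> q 0 = 0.
Proof.
move=> [qD qZ]; apply/eqP; rewrite eq_le; apply/andP; split.
  have h : 0 < 2^-1 :> R by rewrite invr_gt0.
  by have := qZ _ _ h B0; rewrite scaler0; lra.
have := qD 0 0 B0 B0; rewrite addr0 => ?; lra.
Qed.

Lemma sublinear_onN q x : sublinear_on q -> B x -> - q (- x) <= q x.
Proof.
move=> sq Bx; have [qD _] := sq.
have := qD x (- x) Bx (BN Bx); rewrite subrr sublinear_on0// => ?; lra.
Qed.

Lemma sublinear_onZ q (t : R) x : sublinear_on q -> 0 <= t -> B x ->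
  q (t *: x) = t * q x.
Proof.
move=> sq; rewrite le_eqVlt => /predU1P[<- _|t0 Bx].
  by rewrite scale0r mul0r sublinear_on0.
apply/eqP; rewrite eq_le sq.2//=.
have := @sq.2 t^-1 (t *: x) ltac:(by rewrite invr_gt0) (BZ _ Bx).
by rewrite scalerA mulVf ?gt_eqF// scale1r ler_pdivlMl.
Qed.

(** Comparing [q] with its directional infimum
    [x |-> inf_(t >= 0) (q (x + t y) - t q y)], again sublinear, forces the
    superadditivity of a minimal [q]. *)
Let minimal_additive (p q : V -> R) : sublinear_on q ->
  (forall x, B x -> q x <= p x) ->
  (forall q', sublinear_on q' -> (forall x, B x -> q' x <= p x) ->
    (forall x, B x -> q' x <= q x) -> forall x, B x -> q x <= q' x) ->
  forall x y, B x -> B y -> q (x + y) = q x + q y.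
Proof.
move=> sq qp qmin x y Bx By; apply/eqP; rewrite eq_le sq.1//=.
have [qD qZ] := sq.
pose S z := [set q (z + t *: y) - t * q y | t in [set t : R | 0 <= t]].
pose q' z := inf (S z).
have Slb z : B z -> lbound (S z) (- q (- z)).
  move=> Bz _ [t /= t0 <-]; have Bty := BZ t By.
  have := qD (z + t *: y) (- z) (BD Bz Bty) (BN Bz).
  rewrite addrAC subrr add0r sublinear_onZ// => ?; lra.
have Sinf z : B z -> has_inf (S z).
  move=> Bz; split; last by exists (- q (- z)); exact: Slb.
  by exists (q (z + 0 *: y) - 0 * q y); exists 0 => /=.
have q'_le z t : B z -> 0 <= t -> q' z <= q (z + t *: y) - t * q y.
  by move=> Bz t0; apply: ge_inf; [case: (Sinf z Bz)|exists t].
have q'q z : B z -> q' z <= q z.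
  by move=> Bz; have := q'_le z 0 Bz (lexx _);
    rewrite scale0r addr0 mul0r subr0.
have sq' : sublinear_on q'.
  split=> [z1 z2 Bz1 Bz2|t z t0 Bz].
    rewrite -lerBlDr; apply: (@lb_le_inf _ (S z1));
      first by case: (Sinf z1 Bz1).
    move=> _ [t1 /= t10 <-]; rewrite lerBlDr -lerBlDl.
    apply: (@lb_le_inf _ (S z2)); first by case: (Sinf z2 Bz2).
    move=> _ [t2 /= t20 <-].
    have := q'_le (z1 + z2) (t1 + t2) (BD Bz1 Bz2) (addr_ge0 t10 t20).
    have := qD (z1 + t1 *: y) (z2 + t2 *: y) (BD Bz1 (BZ _ By))
      (BD Bz2 (BZ _ By)).
    rewrite addrACA -scalerDl => ? ?; lra.
  rewrite mulrC -ler_pdivrMr//; apply: (@lb_le_inf _ (S z));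
    first by case: (Sinf z Bz).
  move=> _ [s /= s0 <-]; rewrite ler_pdivrMr//.
  have := q'_le (t *: z) (t * s) (BZ _ Bz) (mulr_ge0 (ltW t0) s0).
  rewrite -scalerA -scalerDr (sublinear_onZ sq (ltW t0) (BD Bz (BZ s By))).
  by move=> h; apply: (le_trans h); lra.
have q'p z : B z -> q' z <= p z by move=> Bz;
  exact: le_trans (q'q _ Bz) (qp _ Bz).
have := qmin q' sq' q'p q'q x Bx; have := q'_le x 1 Bx ler01.
rewrite scale1r mul1r => ? ?; lra.
Qed.

(** By Zorn's lemma; the pointwise infimum of a chain is a lower bound, finite
    because a sublinear [q <= p] satisfies [- p (- x) <= q x]. *)
Let ex_minimal (p : V -> R) : sublinear_on p ->
  exists q, [/\ sublinear_on q, (forall x, B x -> q x <= p x) &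
  (forall q', sublinear_on q' -> (forall x, B x -> q' x <= p x) ->
    (forall x, B x -> q' x <= q x) -> forall x, B x -> q x <= q' x)].
Proof.
move=> sp.
pose T := {q : V -> R | sublinear_on q /\ forall x, B x -> q x <= p x}.
pose t0 : T := exist _ p (conj sp (fun x _ => lexx _)).
pose r (q q' : T) := `[< forall x, B x -> sval q' x <= sval q x >].
have [||A Atot|[q [sq qp]] qmax] := @ZL_preorder T t0 r.
- by move=> t; apply/asboolP.
- move=> a b c /asboolP ba /asboolP ac; apply/asboolP => x Bx.
  exact: le_trans (ac x Bx) (ba x Bx).
- have [A0|/set0P[a0 Aa0]] := eqVneq A set0.
    by exists t0 => s; rewrite A0.
  pose S x := [set sval a x | a in A].
  have Slb x : B x -> lbound (S x) (- p (- x)).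
    move=> Bx _ [[a [sa ap]] Aa <-] /=.
    have := sublinear_onN sa Bx; have := ap _ (BN Bx) => ? ?; lra.
  have Sinf x : B x -> has_inf (S x).
    move=> Bx; split; last by exists (- p (- x)); exact: Slb.
    by exists (sval a0 x); exists a0.
  pose q x := inf (S x).
  have q_le a x : A a -> B x -> q x <= sval a x.
    by move=> Aa Bx; apply: ge_inf; [case: (Sinf x Bx)|exists a].
  have sq : sublinear_on q.
    split=> [x y Bx By|t x tpos Bx].
      rewrite -lerBlDr; apply: (@lb_le_inf _ (S x)); first by case: (Sinf x Bx).
      move=> _ [a Aa <-]; rewrite lerBlDr -lerBlDl.
      apply: (@lb_le_inf _ (S y)); first by case: (Sinf y By).
      move=> _ [b Ab <-].
      have [/asboolP ab|/asboolP ba] := Atot _ _ Aa Ab.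
        have := q_le b _ Ab (BD Bx By); have := (svalP b).1.1 x y Bx By.
        have := ab x Bx => ? ? ?; lra.
      have := q_le a _ Aa (BD Bx By); have := (svalP a).1.1 x y Bx By.
      have := ba y By => ? ? ?; lra.
    rewrite mulrC -ler_pdivrMr//; apply: (@lb_le_inf _ (S x)).
      by case: (Sinf x Bx).
    move=> _ [a Aa <-]; rewrite ler_pdivrMr// mulrC.
    exact: le_trans (q_le a _ Aa (BZ t Bx)) ((svalP a).1.2 t x tpos Bx).
  have qp x : B x -> q x <= p x.
    by move=> Bx; exact: le_trans (q_le _ _ Aa0 Bx) ((svalP a0).2 x Bx).
  exists (exist _ q (conj sq qp)) => a Aa; apply/asboolP => x Bx /=.
  exact: q_le.
- exists q; split=> // q' sq' q'p q'q x Bx.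
  have /(_ _)/asboolP := qmax (exist _ q' (conj sq' q'p)).
  by apply=> //; apply/asboolP.
Qed.

(** A sublinear functional dominates a linear one: any minimal sublinear
    functional below it. *)
Lemma hahn_banach (p : V -> R) : sublinear_on p ->
  exists L : V -> R, [/\ forall x y, B x -> B y -> L (x + y) = L x + L y,
    forall (t : R) x, B x -> L (t *: x) = t * L x &
    forall x, B x -> L x <= p x].
Proof.
move=> /ex_minimal[q [sq qp qmin]]; exists q; split=> //.
  exact: minimal_additive qmin.
move=> t x Bx; have [t0|t0] := leP 0 t; first exact: sublinear_onZ.
have qD := minimal_additive sq qp qmin.
have qN y : B y -> q (- y) = - q y.
  move=> By; have := qD _ _ By (BN By); rewrite subrr sublinear_on0// => ?; lra.
rewrite -[t]opprK scaleNr qN; last exact: BZ.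
by rewrite sublinear_onZ// ?mulNr// oppr_ge0 ltW.
Qed.

End sublinear.

(** * A Cantor scheme in an uncountable Polish space *)

Section cantor_scheme.
Context {R : realType} {X : ptopologicalType}.
Variable d : X -> X -> R.
Hypothesis d_metric : is_metric d.
Hypothesis d_top : generates_topology d.
Variable S : set X.
Hypothesis S_countable : countable S.
Hypothesis S_dense : dense S.
Hypothesis X_uncountable : ~ countable [set: X].

Let d0 x : d x x = 0. Proof. by case: d_metric => h _ _; apply/h. Qed.
Let dC x y : d x y = d y x. Proof. by case: d_metric. Qed.
Let dtri y x z : d x z <= d x y + d y z. Proof. by case: d_metric. Qed.
Let d_ge0 x y : 0 <= d x y.
Proof. have := dtri y x x; rewrite d0 (dC y x) => ?; lra. Qed.

Let open_dball x r : open [set y | d x y < r].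
Proof.
rewrite openE => y /= xy; apply/d_top; exists (r - d x y);
  first by rewrite subr_gt0.
by move=> z /= yz; have := dtri y x z => ?; lra.
Qed.

Let closed_dball x r : closed [set y | d x y <= r].
Proof.
rewrite -[X in closed X]setCK closedC openE => y /= /negP; rewrite -ltNge => xy.
apply/d_top; exists (d x y - r); first by rewrite subr_gt0.
move=> z /= yz; apply/negP; rewrite -ltNge; have := dtri z x y.
by rewrite (dC z y) => ?; lra.
Qed.

(** The sets of the Cantor scheme are closed and uncountable. *)
Let fat (C : set X) := closed C /\ ~ countable C.

Let invSn_small (e : R) : 0 < e -> exists n, n.+1%:R^-1 < e.
Proof.
move=> e0; exists (Num.truncn e^-1).
by rewrite invf_plt ?posrE//; exact: truncnS_gt.
Qed.

(** An uncountable set has two distinct condensation points: by separability,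
    its points that are not condensation points form a countable set [N]. *)
Let condensation (C : set X) : ~ countable C -> exists x y, x != y /\
  forall r : R, 0 < r -> ~ countable (C `&` [set z | d x z <= r]) /\
                         ~ countable (C `&` [set z | d y z <= r]).
Proof.
move=> Cunc.
pose A (i : X * nat) := C `&` [set z | d i.1 z < i.2.+1%:R^-1].
pose I := [set i : X * nat | S i.1 /\ countable (A i)].
pose N := \bigcup_(i in I) A i.
have Ncount : countable N.
  apply: bigcup_countable => [|i []//].
  apply: (@sub_countable _ _ _ (S `*` setT)); last exact: countableX.
  by apply: subset_card_le => i [].
have CN x : C x -> ~ N x -> forall r : R, 0 < r ->
  ~ countable (C `&` [set z | d x z <= r]).
  move=> Cx Nx r r0 cr; apply: Nx.
  have [n nr] := @invSn_small (r / 2) ltac:(by rewrite divr_gt0).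
  have [s [/= xs Ss]] := @S_dense [set z | d x z < n.+1%:R^-1]
    ltac:(by exists x; rewrite /= d0 invr_gt0) (open_dball _ _).
  exists (s, n) => /=; last by split => //=; rewrite dC.
  split=> //; apply: sub_countable cr; apply: subset_card_le => z [Cz /= sz].
  by split => //=; have := dtri s x z; move: xs sz nr; set k := _^-1 => *; lra.
apply: contra_notP Cunc => nxy.
have [[x [Cx Nx]]|noCN] := pselect (exists x, C x /\ ~ N x); last first.
  apply: sub_countable Ncount; apply: subset_card_le => x Cx.
  by apply: contra_notP noCN => Nx; exists x.
apply: (@sub_countable _ _ _ (\bigcup_(b in [set: bool])
  (if b then N else [set x]))).
  apply: subset_card_le => z Cz; have [Nz|Nz] := pselect (N z);
    first by exists true.
  exists false => //=; apply: contra_notP nxy => zx; exists x, z; split.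
    by apply/eqP => xz; apply: zx.
  by move=> r r0; split; exact: CN.
by apply: bigcup_countable => [|[] _] //; exact: countable1.
Qed.

Let fat_split (C : set X) (e : R) : fat C -> 0 < e -> exists p : set X * set X,
  [/\ fat p.1, fat p.2, p.1 `<=` C /\ p.2 `<=` C, p.1 `&` p.2 = set0 &
   forall b, forall x y, (if b then p.2 else p.1) x ->
     (if b then p.2 else p.1) y -> d x y <= e].
Proof.
move=> [Ccl Cunc] e0; have [x [y [xy h]]] := condensation Cunc.
have dxy : 0 < d x y.
  rewrite lt_neqAle d_ge0 andbT; apply: contra_neq xy => /esym.
  by case: d_metric => h1 _ _ /h1.
pose r := Num.min (e / 2) (d x y / 3).
have r0 : 0 < r by rewrite lt_min !divr_gt0.
have re : r <= e / 2 by rewrite ge_min lexx.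
have rd : r <= d x y / 3 by rewrite ge_min lexx orbT.
have [hx hy] := h _ r0.
exists (C `&` [set z | d x z <= r], C `&` [set z | d y z <= r]); split => //=.
- by split=> //; apply: closedI => //; exact: closed_dball.
- by split=> //; apply: closedI => //; exact: closed_dball.
- by rewrite -subset0 => z [[_ /= xz] [_ /= yz]]; have := dtri z x y;
  rewrite (dC z) => ?; lra.
- have aux c u v : d c u <= r -> d c v <= r -> d u v <= e.
    by move=> cu cv; have := dtri c u v; rewrite (dC u c) => ?; lra.
  by case=> u v [_ /= cu] [_ /= cv]; exact: aux cu cv.
Qed.

(** At level [n] the sets indexed by [k < 2 ^ n] are pairwise disjoint, and
    [C n.+1 k] refines [C n k./2].  Larger indices are allowed, but carry no
    disjointness. *)
Lemma cantor_scheme : exists C : nat -> nat -> set X,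
  [/\ (forall n k, closed (C n k)),
      (forall n k, C n k !=set0),
      (forall n k, C n.+1 k `<=` C n k./2),
      (forall n k x y, C n.+1 k x -> C n.+1 k y -> d x y <= n.+1%:R^-1) &
      (forall k x, C 0 k x) /\
      (forall n k k' x, (k < 2 ^ n)%N -> (k' < 2 ^ n)%N -> C n k x ->
        C n k' x -> k = k')].
Proof.
pose Q (nC : nat * set X) (p : set X * set X) := fat nC.2 ->
  [/\ fat p.1, fat p.2, p.1 `<=` nC.2 /\ p.2 `<=` nC.2, p.1 `&` p.2 = set0 &
      forall b, forall x y, (if b then p.2 else p.1) x ->
         (if b then p.2 else p.1) y -> d x y <= nC.1.+1%:R^-1].
have /choice[sp spP] : forall nC, exists p, Q nC p.
  move=> [n C].
  have [fC|nfC] := pselect (fat C); last by exists (C, C) => fC.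
  by have [p hp] := @fat_split C n.+1%:R^-1 fC ltac:(by rewrite invr_gt0);
    exists p.
pose C := fix C n k : set X := match n with 0%N => setT | n'.+1 =>
   if odd k then (sp (n', C n' k./2)).2 else (sp (n', C n' k./2)).1 end.
have fatC n k : fat (C n k).
  elim: n k => [|n IH] k; first by split=> //; exact: closedT.
  by have [f1 f2 _ _ _] := spP (n, C n k./2) (IH _); rewrite /=; case: odd.
exists C; split=> [n k|n k|n k|n k x y|].
- by case: (fatC n k).
- apply/set0P/eqP => C0; have [_] := fatC n k; rewrite C0; apply.
  exact: countable0.
- have [_ _ [s1 s2] _ _] := spP (n, C n k./2) (fatC _ _).
  by rewrite /=; case: odd.
- have [_ _ _ _ h] := spP (n, C n k./2) (fatC _ _).
  by have := h (odd k) x y; rewrite /=; case: odd.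
split=> // n; elim: n => [|n IH] k k' x.
  by rewrite expn0 !ltnS !leqn0 => /eqP -> /eqP ->.
move=> kn k'n xk xk'.
have [_ _ [s1 s2] s0 _] := spP (n, C n k./2) (fatC _ _).
have [_ _ [s1' s2'] _ _] := spP (n, C n k'./2) (fatC _ _).
have kk' : k./2 = k'./2.
  apply: (IH _ _ x).
  - by rewrite ltn_half_double -muln2 mulnC -expnS.
  - by rewrite ltn_half_double -muln2 mulnC -expnS.
  - by move: xk => /=; case: odd => [/s2|/s1].
  - by move: xk' => /=; case: odd => [/s2'|/s1'].
rewrite -[k]odd_double_half -[k']odd_double_half kk'; congr (_ + _)%N.
move: xk xk' => /=; rewrite -kk'; case: odd; case: odd => //= h1 h2; exfalso.
  by rewrite -[False]/(set0 x) -s0.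
by rewrite -[False]/(set0 x) -s0.
Qed.

End cantor_scheme.

(** * A uniform random variable on an uncountable Polish space *)

Lemma dyadic_half (R : realType) (v : R) n : 0 <= v ->
  (Num.truncn (2 ^+ n.+1 * v))./2 = Num.truncn (2 ^+ n * v).
Proof.
move=> v0; apply/esym/eqP; rewrite truncn_eq ?mulr_ge0 ?exprn_ge0//.
set k := Num.truncn _.
have := @truncn_itv _ (2 ^+ n.+1 * v) ltac:(by rewrite mulr_ge0 ?exprn_ge0).
rewrite -/k exprS -mulrA; set y := 2 ^+ n * v => /andP[k1 k2].
have ho : (odd k)%:R <= 1 :> R by rewrite lern1 leq_b1.
have ho' : 0 <= (odd k)%:R :> R by [].
have kE : k%:R = (odd k)%:R + k./2%:R * 2 :> R.
  by rewrite -[in LHS](odd_double_half k) natrD -muln2 natrM.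
have kS : k.+1%:R = k%:R + 1 :> R by rewrite natr1.
have hS : k./2.+1%:R = k./2%:R + 1 :> R by rewrite natr1.
by apply/andP; split; lra.
Qed.

Lemma truncn_dyadic (R : realType) (v : R) n j : 0 <= v ->
  (Num.truncn (2 ^+ n * v) == j) = (j%:R / 2 ^+ n <= v < j.+1%:R / 2 ^+ n).
Proof.
move=> v0; rewrite truncn_eq ?mulr_ge0 ?exprn_ge0//.
by rewrite mulrC -ler_pdivrMr ?exprn_gt0// -ltr_pdivlMr ?exprn_gt0.
Qed.

(** The probability is the image of the uniform law by a map [T] that sends [u]
    to a point of the sets of the Cantor scheme indexed by the binary digits of
    [1 - u].  Reading the digits back gives [V] with [V (T u) = 1 - u]. *)
Lemma polish_uniform (R : realType) (X : ptopologicalType) :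
  polish R X -> ~ countable [set: X] ->
  exists (P : prob X R) (U : borel X -> R),
  [/\ measurable_fun [set: borel X] U, (forall x, 0 < U x <= 1) &
   forall f : R -> \bar R, measurable_fun [set: R] f ->
     (forall x, 0 <= f x)%E ->
   (\int[P]_x f (U x) = \int[lebesgue_measure]_(u in `]0%R, 1%R]) f u)%E].
Proof.
move=> [[S Sc Sd] [d [dm dt dcomp]]] hunc.
have [C [Ccl C0 Cnest Cdiam [CT Cdisj]]] := cantor_scheme dm dt Sc Sd hunc.
(* the index at level n of the dyadic interval that contains v *)
pose k n (v : R) := Num.truncn (2 ^+ n * v).
have Cchain v m n : 0 <= v -> (n <= m)%N -> C m (k m v) `<=` C n (k n v).
  move=> v0 /subnK <-; elim: (m - n)%N => [//|j IH].
  apply: subset_trans IH; rewrite addSn.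
  have <- : (k (j + n).+1 v)./2 = k (j + n)%N v by rewrite /k dyadic_half.
  exact: Cnest.
have /choice[T0 T0P] : forall v, exists x, 0 <= v -> forall n, C n (k n v) x.
  move=> v; have [v0|v0] := leP 0 v; last by exists point.
  have /choice[u uP] : forall n, exists x, C n (k n v) x by move=> n; exact: C0.
  have [e e0|l ul] := dcomp u.
    exists (Num.truncn e^-1).+1 => m n Nm Nn.
    apply: (@le_lt_trans _ _ (Num.truncn e^-1).+1%:R^-1).
      apply: Cdiam; first exact: Cchain Nm _ (uP m).
      exact: Cchain Nn _ (uP n).
    by rewrite invf_plt ?posrE//; exact: truncnS_gt.
  exists l => _ n; apply: (closed_cvg _ (Ccl n (k n v)) _ _ ul).
  by near=> m; apply: (Cchain v m n v0 _ _ (uP m)); near: m;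
    exact: nbhs_infty_ge.
have T0open v O : 0 <= v -> open O -> O (T0 v) <-> exists n, C n (k n v) `<=` O.
  move=> v0 oO; split=> [OT|[n CO]]; last exact/CO/T0P.
  have /dt[e e0 eO] : nbhs (T0 v) O by exact: open_nbhs_nbhs.
  exists (Num.truncn e^-1).+1 => x Cx; apply: eO => /=.
  apply: (@le_lt_trans _ _ (Num.truncn e^-1).+1%:R^-1).
    by apply: Cdiam; [exact: T0P|exact: Cx].
  by rewrite invf_plt ?posrE//; exact: truncnS_gt.
pose T (u : measurableTypeR R) : borel X :=
  if (0 < u <= 1)%R then T0 (1 - u) else point.
have mT : measurable_fun setT T.
  apply: (@measurability _ _ (measurableTypeR R) (borel X) setT T (@open X)).
    by [].
  move=> _ [ O oO <-]; rewrite setTI.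
  have -> : T @^-1` O = (`]0%R, 1%R]%classic `&`
    \bigcup_n \bigcup_(j in [set j | C n j `<=` O])
      `](1 - j.+1%:R / 2 ^+ n)%R, (1 - j%:R / 2 ^+ n)%R]%classic) `|`
    (if `[< O point >] then ~` `]0%R, 1%R]%classic else set0).
    apply/seteqP; split=> u /=; rewrite in_itv/= /T.
      case: ifPn => [u01 Ou|u01 /asboolT ->]; last first.
        by right => /=; rewrite in_itv/=; apply/negP.
      have u1 : 0 <= 1 - u by lra.
      left; split => //; have /(T0open _ _ u1 oO)[n nO] := Ou; exists n => //;
        exists (k n (1 - u)) => //=.
      have := truncn_dyadic n (k n (1 - u)) u1; rewrite eqxx in_itv/= => /esym.
      by move=> /andP[h1 h2]; rewrite ltrBlDr -ltrBlDl h2 lerBrDl -lerBrDr h1.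
    case=> [[u01 [n _ [j /= jO]]]|].
      rewrite u01 in_itv/= => /andP[h1 h2].
      have u1 : 0 <= 1 - u by lra.
      apply/(T0open _ _ u1 oO); exists n; suff -> : k n (1 - u) = j by [].
      apply/eqP; rewrite truncn_dyadic//.
      by rewrite ltrBlDr -ltrBlDl h1 lerBrDl -lerBrDr h2.
    by case: ifPn => // /asboolP Op; rewrite /= in_itv/= => /negP/negbTE ->.
  apply: measurableU; last by case: ifPn => // _; exact: measurableC.
  apply: measurableI => //; apply: bigcupT_measurable => n.
  by apply: bigcup_measurable => j _.
pose Tm := HB.pack_for {mfun measurableTypeR R >-> borel X} T
  (isMeasurableFun.Build _ _ _ _ T mT).
pose A x := [set y : R | exists n j,
  [/\ (j < 2 ^ n)%N, C n j x & y = j%:R / 2 ^+ n]].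
pose V (x : borel X) : R := sup (A x).
have Asup x : has_sup (A x).
  split; first by exists 0, 0%N, 0%N; split => //; rewrite mul0r.
  exists 1 => _ [n [j [jn _ ->]]]; rewrite ler_pdivrMr ?exprn_gt0// mul1r.
  by rewrite -natrX ler_nat ltnW.
have V0 x : 0 <= V x.
  by apply: ub_le_sup; [case: (Asup x)|exists 0%N, 0%N; split => //;
    rewrite mul0r].
have VT v : 0 <= v < 1 -> V (T0 v) = v.
  move=> /andP[v0 v1].
  have kv n : (k n v)%:R / 2 ^+ n <= v < (k n v)%:R / 2 ^+ n + (2 ^+ n)^-1.
    have := truncn_dyadic n (k n v) v0; rewrite eqxx => /esym.
    by rewrite -[(k n v).+1%:R]natr1 mulrDl mul1r.
  have k2 n : (k n v < 2 ^ n)%N.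
    rewrite truncn_lt_nat ?mulr_ge0 ?exprn_ge0// natrX.
    by rewrite gtr_pMr ?exprn_gt0.
  apply/eqP; rewrite eq_le; apply/andP; split.
    apply: ge_sup; first by case: (Asup (T0 v)).
    move=> _ [n [j [jn Cj ->]]]; have -> : j = k n v.
      exact: Cdisj jn (k2 n) Cj (T0P v v0 n).
    by case/andP: (kv n).
  rewrite leNgt; apply/negP => Vv.
  pose n := Num.truncn (v - V (T0 v))^-1.
  have : (2 ^+ n)^-1 <= v - V (T0 v).
    rewrite invf_ple ?posrE ?exprn_gt0 ?subr_gt0//.
    apply: (@le_trans _ _ n.+1%:R); first exact/ltW/truncnS_gt.
    by rewrite -natrX ler_nat ltn_expl.
  have : (k n v)%:R / 2 ^+ n <= V (T0 v).
    apply: ub_le_sup; first by case: (Asup (T0 v)).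
    by exists n, (k n v); split => //; exact: T0P.
  have /andP[_] := kv n; lra.
have mV : measurable_fun setT V.
  apply: (measurability (@RGenOInfty.G R)).
    exact: RGenOInfty.measurableE.
  move=> _ [_ [a ->] <-]; rewrite setTI.
  have -> : V @^-1` `]a, +oo[ = \bigcup_n
    \bigcup_(j in [set j | (j < 2 ^ n)%N /\ a < j%:R / 2 ^+ n]) C n j.
    apply/seteqP; split=> x /=; rewrite in_itv/= andbT.
      move=> /sup_gt[|_ [n [j [jn Cj ->]]] aj]; first by case: (Asup x).
      by exists n => //; exists j.
    move=> [n _ [j /= [jn aj] Cj]]; apply: (lt_le_trans aj).
    by apply: ub_le_sup; [case: (Asup x)|exists n, j].
  apply: bigcupT_measurable => n; apply: bigcup_measurable => j _.
  rewrite -[C n j]setCK; apply: measurableC; apply: sub_sigma_algebra.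
  exact/closed_openC.
(* V may be 1 outside the range of T; there the value 1 of U keeps U positive *)
pose U x : R := if V x < 1 then 1 - V x else 1.
have mU : measurable_fun setT U.
  apply: measurable_fun_ifT => //.
    exact: measurable_fun_ltr.
  exact: measurable_funB.
have UT u : 0 < u <= 1 -> U (T u) = u.
  by move=> u01; rewrite /U /T u01 VT ?ifT; lra.
pose P := distribution (uniform_prob (@ltr01 R)) Tm.
exists P, U; split => //.
  by move=> x; have := V0 x; rewrite /U; case: ifPn; lra.
move=> f mf f0.
have mfU : measurable_fun setT (f \o U) by exact: measurableT_comp.
rewrite [LHS](@ge0_integral_pushforward _ _ _ _ R T mT (uniform_prob (@ltr01 R))
  setT (f \o U))//=.
rewrite preimage_setT integral_uniform//=;
  last exact: (measurableT_comp mfU mT).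
rewrite subr0 invr1 mul1e -[LHS]integral_itv_obnd_cbnd; last first.
  apply: measurable_funTS; exact: (measurableT_comp mfU mT).
by apply: eq_integral => u; rewrite inE/= in_itv/= => u01; rewrite UT.
Unshelve. all: by end_near. Qed.

(** * Quantile functions *)

Section quantiles.
Context {R : realType} {X : ptopologicalType}.
Implicit Types (Z : X -> R) (P : prob X R).

Lemma bounded_fun_exP Z : bounded_fun Z <-> exists M, forall x, `|Z x| <= M.
Proof.
split=> [[M [_ h]]|[M h]].
  by exists (M + 1) => x; apply: h => //; rewrite ltrDl.
by exists M; split; [exact: num_real|move=> N MN x _;
  apply: le_trans (h x) (ltW MN)].
Qed.

Lemma bmeas_setle Z (eta : R) : bmeas R X Z ->
  measurable ([set x | Z x <= eta] : set (borel X)).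
Proof.
move=> [mZ _]; have -> : [set x | Z x <= eta] = Z @^-1` `]-oo, eta].
  by apply/seteqP; split=> x /=; rewrite in_itv.
by rewrite -[X in measurable X]setTI; exact: mZ.
Qed.

(** Right-continuity of the distribution function. *)
Lemma prob_setle_right Z P (eta p : R) : bmeas R X Z ->
  (forall e : R, 0 < e -> (p%:E <= P [set x | (Z x <= eta + e)%R])%E) ->
  (p%:E <= P [set x | (Z x <= eta)%R])%E.
Proof.
move=> bZ h; pose S n := [set x | Z x <= eta + n.+1%:R^-1].
have SE : [set x | Z x <= eta] = \bigcap_n S n.
  apply/seteqP; split=> x /=; first by move=> Zx n _;
    rewrite /S /= (le_trans Zx)// lerDl.
  move=> Sx; apply/ler_addgt0Pr => e e0.
  apply: le_trans (Sx (Num.truncn e^-1) I) _.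
  by rewrite lerD2l invf_ple ?posrE//; exact/ltW/truncnS_gt.
have mS n : measurable (S n : set (borel X)) by exact: bmeas_setle.
have : P (S n) @[n --> \oo] --> P (\bigcap_n S n).
  apply: nonincreasing_cvg_mu => //.
  - by rewrite (le_lt_trans (probability_le1 P (mS 0%N)))// ltry.
  - exact: bigcapT_measurable.
  - apply/nonincreasing_seqP => n; apply/subsetPset => x;
    rewrite /S /= => /le_trans; apply.
    by rewrite lerD2l lef_pV2 ?posrE// ler_nat.
move=> cS; rewrite SE -(cvg_lim _ cS)//; apply: lime_ge; first by apply/cvg_ex;
  exists (P (\bigcap_n S n)).
by near=> n; apply: h; rewrite invr_gt0.
Unshelve. all: by end_near. Qed.

Lemma has_inf_quantile Z P p : bmeas R X Z -> 0 < p <= 1 ->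
  has_inf [set eta : R | (p%:E <= P [set x | (Z x <= eta)%R])%E].
Proof.
move=> [mZ /bounded_fun_exP[M ZM]] /andP[p0 p1]; split.
  exists M => /=; rewrite (_ : [set x | _] = setT) ?probability_setT ?lee_fin//.
  by apply/seteqP; split => // x _ /=; rewrite (le_trans (ler_norm _)).
exists (- M) => eta /= h; rewrite leNgt; apply/negP => etaM; move: h.
rewrite (_ : [set x | _] = set0); first by rewrite measure0 lee_fin leNgt p0.
rewrite -subset0 => x /= Zx; have := ler_norm (- Z x); rewrite normrN.
have := ZM x; lra.
Qed.

(** Galois connection between the quantile function and the distribution
    function. *)
Lemma quantile_le Z P p eta : bmeas R X Z -> 0 < p <= 1 ->
  (quantile Z P p <= eta) = (p%:E <= P [set x | (Z x <= eta)%R])%E.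
Proof.
move=> bZ p01; have [qn qb] := has_inf_quantile P bZ p01.
apply/idP/idP => [q_eta|p_eta]; last exact: ge_inf.
apply: prob_setle_right => // e e0.
have [eta' /= h1 h2] := inf_adherent e0 (conj qn qb).
apply: (le_trans h1); apply: le_measure; rewrite ?inE; try exact: bmeas_setle.
move=> x /= /le_trans; apply; apply: (le_trans (ltW h2)).
by rewrite lerD2r.
Qed.

Lemma quantile_gt Z P : bmeas R X Z -> forall eta, exists2 q, 0 <= q <= 1 &
  forall p, 0 < p <= 1 -> (eta < quantile Z P p) = (q < p).
Proof.
move=> bZ eta; have mS := bmeas_setle eta bZ.
have fS : P [set x | (Z x <= eta)%R] \is a fin_num by exact: fin_num_measure.
exists (fine (P [set x | (Z x <= eta)%R])).
  rewrite fine_ge0//= -lee_fin fineK//; exact: probability_le1.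
by move=> p p01; rewrite !ltNge quantile_le// -lee_fin fineK.
Qed.

Lemma quantile_homo Z P p q : bmeas R X Z -> 0 < p -> p <= q -> q <= 1 ->
  quantile Z P p <= quantile Z P q.
Proof.
move=> bZ p0 pq q1; rewrite quantile_le//; last by rewrite p0 (le_trans pq).
apply: (@le_trans _ _ q%:E); first by rewrite lee_fin.
by rewrite -quantile_le// q1 (lt_le_trans p0).
Qed.

Lemma quantile_norm_le Z P M p : bmeas R X Z -> (forall x, `|Z x| <= M) ->
  0 < p <= 1 -> `|quantile Z P p| <= M.
Proof.
move=> bZ ZM p01; have /andP[p0 p1] := p01; rewrite ler_norml; apply/andP;
  split.
  apply: lb_le_inf; first by case: (has_inf_quantile P bZ p01).
  move=> eta /= h; rewrite leNgt; apply/negP => etaM; move: h.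
  rewrite (_ : [set x | _] = set0); first by rewrite measure0 lee_fin leNgt p0.
  rewrite -subset0 => x /= Zx; have := ler_norm (- Z x); rewrite normrN.
  have := ZM x; lra.
rewrite quantile_le// (_ : [set x | _] = setT) ?probability_setT ?lee_fin//.
by apply/seteqP; split => // x _ /=; rewrite (le_trans (ler_norm _)).
Qed.

Lemma quantile_scale Z P b p : bmeas R X Z -> 0 < b -> 0 < p <= 1 ->
  quantile (fun x => b * Z x) P p = b * quantile Z P p.
Proof.
move=> bZ b0 p01; have [mZ /bounded_fun_exP[M ZM]] := bZ.
have bbZ : bmeas R X (fun x => b * Z x).
  split; first by apply: measurable_funM => //; exact: measurable_cst.
  apply/bounded_fun_exP; exists (b * M) => x.
  by rewrite normrM (gtr0_norm b0) ler_pM2l.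
have E eta : (quantile (fun x => b * Z x) P p <= eta) =
  (b * quantile Z P p <= eta).
  rewrite mulrC -ler_pdivlMr// !quantile_le//; congr (_ <= P _)%E.
  by apply/seteqP; split=> x /=; rewrite ler_pdivlMr// mulrC.
by apply/eqP; rewrite eq_le E lexx/= -E.
Qed.

(** Functions with the same distribution function are comparable in the
    increasing convex order. *)
Lemma icx_of_cdf Z P Z' P' : bmeas R X Z -> bmeas R X Z' ->
  (forall eta, P [set x | (Z x <= eta)%R] = P' [set x | (Z' x <= eta)%R]) ->
  icx Z P Z' P'.
Proof.
move=> [mZ _] [mZ' _] h eta.
pose Zm := HB.pack_for {mfun borel X >-> R} (Z : borel X -> R)
  (isMeasurableFun.Build _ _ _ _ (Z : borel X -> R) mZ).
pose Zm' := HB.pack_for {mfun borel X >-> R} (Z' : borel X -> R)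
  (isMeasurableFun.Build _ _ _ _ (Z' : borel X -> R) mZ').
have e (A : set R) : measurable A ->
  distribution P Zm A = distribution P' Zm' A.
  move=> mA; have : <<s @RGenOInfty.G R >> A.
    have : (@RGenOInfty.G R).-sigma.-measurable A by rewrite
      -RGenOInfty.measurableE.
    by [].
  apply: (@g_sigma_algebra_measure_unique _ R R (@RGenOInfty.G R) _
    (fun n => `]- n%:R, +oo[%classic)) => //.
  - by move=> _ [x ->].
  - by move=> n; exists (- n%:R).
  - apply/seteqP; split => // x _; exists (Num.truncn `|x|).+1 => //=.
    rewrite in_itv/= andbT ltrNl (le_lt_trans _ (truncnS_gt _))//.
    by rewrite -normrN ler_norm.
  - move=> _ _ [x ->] [y ->]; exists (Num.max x y).
    by apply/seteqP; split=> z /=; rewrite !in_itv/= !andbT gt_max => /andP.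
  - move=> _ [x ->].
    have -> : `]x, +oo[%classic = ~` `]-oo, x]%classic :> set R by rewrite
      setCitvl.
    have dC (Q : prob X R) (W : {mfun borel X >-> R}) :
        distribution Q W (~` `]-oo, x]%classic) =
        (1 - Q [set z | (W z <= x)%R])%E.
      have mW : measurable (W @^-1` `]-oo, x]) by apply: measurable_funPTI.
      rewrite /distribution /pushforward preimage_setC probability_setC//.
    by rewrite [LHS](dC P Zm) [RHS](dC P' Zm') [X in (_ - X)%E](h x).
  - by move=> k; rewrite (le_lt_trans (probability_le1 _ _))// ltry.
pose g (y : R) := (Num.max 0 (y - eta))%:E : \bar R.
have mg : measurable_fun setT g.
  by apply/measurable_EFinP; apply: measurable_maxr => //;
    exact: measurable_funB.
have g0 y : (0 <= g y)%E by rewrite lee_fin le_max lexx.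
have intE Q (W : {mfun borel X >-> R}) :
    (\int[Q : prob X R]_x g (W x) = \int[distribution Q W]_y g y)%E.
  rewrite ge0_integral_pushforward//= ?preimage_setT//; exact: measurable_funP.
rewrite [leLHS](intE P Zm) [leRHS](intE P' Zm')
  (eq_measure_integral (distribution P' Zm'))//.
by move=> A mA _; exact: e.
Qed.
End quantiles.

(** * Bounded nondecreasing functions on (0,1] and their tail integrals *)

Lemma Rintegral_lincomb d (T : measurableType d) (R : realType)
    (mu : {measure set T -> \bar R}) (D : set T) (f g : T -> R) (a b : R) :
  measurable D -> mu.-integrable D (EFin \o f) ->
  mu.-integrable D (EFin \o g) ->
  \int[mu]_(x in D) (a * f x + b * g x) =
  a * \int[mu]_(x in D) f x + b * \int[mu]_(x in D) g x.
Proof.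
move=> mD i1 i2; rewrite RintegralD//; last 2 first.
- exact: (integrableZl _ a i1).
- exact: (integrableZl _ b i2).
by rewrite !RintegralZl.
Qed.

Section mono01.
Context {R : realType}.
Implicit Types (phi psi : R -> R).
Local Notation leb := (@lebesgue_measure R).

(** Functions on (0,1] are represented by functions on the line, whose values
    outside (0,1] are irrelevant. *)
Definition bounded01 phi := exists M, forall u, 0 < u <= 1 -> `|phi u| <= M.

(** Bounded nondecreasing functions on (0,1]. *)
Definition mono01 phi := bounded01 phi /\
  forall u v, 0 < u -> u <= v -> v <= 1 -> phi u <= phi v.

(** The integral of [phi] over (a,1]. *)
Definition tail_int phi (a : R) := \int[leb]_(u in `]a, 1%R]) phi u.

Lemma measurable_mono01 phi : mono01 phi ->
  measurable_fun (`]0%R, 1%R] : set R) phi.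
Proof.
move=> [_ hphi]; apply: (measurability (@RGenCInfty.G R)) =>
  [|/= _ [_] [r] -> <-].
  exact: RGenCInfty.measurableE.
apply: is_interval_measurable => s t/=.
rewrite !in_itv/= !andbT => -[s01 fs] [t01 ft] u /andP[su ut].
split; first by rewrite in_itv/=; lra.
by rewrite in_itv/= andbT (le_trans fs)// hphi//; lra.
Qed.

Lemma integrable_bounded01 phi : bounded01 phi ->
  measurable_fun (`]0%R, 1%R] : set R) phi ->
    leb.-integrable `]0, 1] (EFin \o phi).
Proof.
move=> [M hM] mphi; apply: measurable_bounded_integrable => //=.
  by rewrite lebesgue_measure_itv/= lte_fin ltr01 ltry.
exists M; split; first exact: num_real.
by move=> N MN x /=; rewrite in_itv/= => /hM /le_trans; apply; exact: ltW.
Qed.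

Lemma integrable_mono01 phi (a b : R) : mono01 phi -> 0 <= a -> b <= 1 ->
  leb.-integrable `]a, b] (EFin \o phi).
Proof.
move=> mphi a0 b1; apply: (@integrableS _ _ _ leb `]0, 1]%classic) => //.
  by move=> x /=; rewrite !in_itv/=; lra.
by apply: integrable_bounded01; [case: mphi|exact: measurable_mono01].
Qed.

Lemma mono01_lin phi psi (a b : R) : mono01 phi -> mono01 psi -> 0 <= a ->
  0 <= b ->
  mono01 (fun u => a * phi u + b * psi u).
Proof.
move=> [[M hM] mphi] [[N hN] mpsi] a0 b0; split.
  exists (a * M + b * N) => u u01; rewrite (le_trans (ler_normD _ _))//.
  by rewrite !normrM (ger0_norm a0) (ger0_norm b0) lerD// ler_wpM2l// ?hM ?hN.
by move=> u v u0 uv v1; rewrite lerD// ler_wpM2l// ?mphi ?mpsi.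
Qed.

Lemma mono01_cst (c : R) : mono01 (fun=> c).
Proof. by split=> //; exists `|c|. Qed.

(** The indicator function of the half-line to the right of [q]. *)
Definition step (q u : R) : R := (q < u)%R%:R.

Lemma mono01_step (q : R) : mono01 (step q).
Proof.
rewrite /step; split; first by exists 1 => u _; case: (q < u)%R;
  rewrite ?normr1// normr0.
by move=> u v _ uv _; rewrite ler_nat; case: ltP => // qu;
  rewrite (lt_le_trans qu).
Qed.

Lemma tail_int_lin phi psi (a b : R) alpha : mono01 phi -> mono01 psi ->
  0 <= alpha ->
  tail_int (fun u => a * phi u + b * psi u) alpha =
  a * tail_int phi alpha + b * tail_int psi alpha.
Proof.
move=> mphi mpsi a0.
by apply: Rintegral_lincomb => //; exact: integrable_mono01.
Qed.

Lemma tail_int_cst (c : R) alpha : 0 <= alpha <= 1 ->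
  tail_int (fun=> c) alpha = c * (1 - alpha).
Proof.
move=> /andP[a0 a1]; rewrite /tail_int Rintegral_cst//= lebesgue_measure_itv/=.
rewrite lte_fin; case: ltP => // a1'.
have -> : alpha = 1 by lra.
by rewrite subrr.
Qed.

Lemma stepE (q : R) : step q = \1_(`]q, +oo[).
Proof. by apply/funext => u; rewrite indicE mem_setE in_itv/= andbT. Qed.

Lemma tail_int_step (q alpha : R) : 0 <= q <= 1 -> 0 <= alpha <= 1 ->
  tail_int (step q) alpha = 1 - Num.max alpha q.
Proof.
move=> q01 a01; rewrite /tail_int stepE /Rintegral integral_indic//.
have -> : `]q, +oo[ `&` `]alpha, 1] = `]Num.max alpha q, 1]%classic :> set R.
  apply/seteqP; split=> u /=; rewrite !in_itv/= andbT gt_max.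
    by move=> [-> /andP[-> ->]].
  by move=> /andP[/andP[-> ->] ->].
rewrite [X in fine X]lebesgue_measure_itv/= lte_fin; case: ltP => //.
rewrite le_max => h; have -> : Num.max alpha q = 1; last by rewrite subrr.
by apply/eqP; rewrite eq_le ge_max le_max; lra.
Qed.

Lemma le_tail_int phi psi alpha : mono01 phi -> mono01 psi -> 0 <= alpha ->
  (forall u, 0 < u <= 1 -> phi u <= psi u) ->
    tail_int phi alpha <= tail_int psi alpha.
Proof.
move=> mphi mpsi a0 h; apply: le_Rintegral => //.
- exact: integrable_mono01.
- exact: integrable_mono01.
- by move=> u /=; rewrite in_itv/= => u01; apply: h; lra.
Qed.

Lemma mono01_pospart phi (eta : R) : mono01 phi ->
  mono01 (fun u => Num.max 0 (phi u - eta)).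
Proof.
move=> [[M hM] mphi]; split.
  exists (M + `|eta|) => u /hM; rewrite ler_norml => /andP[h1 h2].
  rewrite ger0_norm ?le_max ?lexx// ge_max.
  have := ler_norm (- eta); rewrite normrN => h3; have := normr_ge0 eta => h4.
  by apply/andP; split; lra.
move=> u v u0 uv v1; have := mphi u v u0 uv v1.
by rewrite ge_max !le_max lexx/= => ?; apply/orP; right; lra.
Qed.

(** The order of the tail integrals implies the increasing convex order: if [c]
    is the point where [phi] crosses the level [eta], the left-hand side is
    [tail_int phi c - eta * (1 - c)], and the same expression in [psi] is at
    most the right-hand side. *)
Lemma le_integral_pospart phi psi (eta : R) : mono01 phi -> mono01 psi ->
  (forall alpha, 0 <= alpha <= 1 -> tail_int phi alpha <= tail_int psi alpha) ->
  \int[leb]_(u in `]0, 1]) Num.max 0 (phi u - eta) <=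
  \int[leb]_(u in `]0, 1]) Num.max 0 (psi u - eta).
Proof.
move=> mphi mpsi h.
have mpos xi : mono01 xi -> mono01 (fun u => Num.max 0 (xi u - eta)).
  exact: mono01_pospart.
pose S := [set u : R | u = 0 \/ (0 < u <= 1 /\ phi u <= eta)].
have Sub : has_sup S.
  by split; [exists 0; left|exists 1 => u [->|[]]]; lra.
pose c := sup S.
have c0 : 0 <= c by apply: ub_le_sup; [case: Sub|left].
have c1 : c <= 1.
  by apply: ge_sup; [case: Sub|move=> u [->|[]]; lra].
have splitI xi : mono01 xi -> \int[leb]_(u in `]0, 1]) xi u =
    \int[leb]_(u in `]0, c]) xi u + \int[leb]_(u in `]c, 1]) xi u.
  move=> mxi; have ixi := integrable_mono01 mxi (lexx 0) (lexx 1).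
  have := @Rintegral_itvB R xi (BRight 0) (BRight 1) c ixi.
  by rewrite !bnd_simp => /(_ c0 c1) <-; rewrite addrC subrK.
have -> : \int[leb]_(u in `]0, 1]) Num.max 0 (phi u - eta) =
    tail_int phi c - eta * (1 - c).
  rewrite (splitI _ (mpos _ mphi)) -Rintegral_itv_bndo_bndc; last first.
    apply: integrableS (integrable_mono01 (mpos _ mphi) (lexx 0) c1) => //.
    by move=> u /=; rewrite !in_itv/= => /andP[-> /ltW].
  rewrite (@eq_Rintegral _ _ _ _ _ (fun=> 0)); last first.
    move=> u; rewrite inE/= in_itv/= => /andP[u0 uc]; apply/max_idPl.
    have [v [v0|[v01 pv]] uv] := sup_gt (proj1 Sub) uc; first by lra.
    have := mphi.2 u v; lra.
  rewrite Rintegral_cst// mul0r add0r.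
  transitivity (tail_int (fun u => 1 * phi u + 1 * (- eta)) c).
    apply: eq_Rintegral => u; rewrite inE/= in_itv/= => /andP[cu u1];
      rewrite !mul1r.
    apply/max_idPr; rewrite leNgt; apply/negP => pu.
    have : u <= c by apply: ub_le_sup; [case: Sub|right; split; lra].
    lra.
  rewrite (tail_int_lin 1 1 mphi (mono01_cst (- eta)) c0).
  by rewrite tail_int_cst ?c0// !mul1r mulNr.
rewrite (splitI _ (mpos _ mpsi)).
have := h c ltac:(by rewrite c0).
have : tail_int (fun u => 1 * psi u + 1 * (- eta)) c <=
    tail_int (fun u => Num.max 0 (psi u - eta)) c.
  apply: le_Rintegral => //.
  - apply: (integrable_mono01 _ c0 (lexx 1)).
    exact: mono01_lin mpsi (mono01_cst _) ler01 ler01.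
  - exact: integrable_mono01 (mpos _ mpsi) _ _.
  - by move=> u _; rewrite !mul1r le_max lexx orbT.
rewrite (tail_int_lin 1 1 mpsi (mono01_cst (- eta)) c0).
rewrite tail_int_cst ?c0// !mul1r mulNr.
have : 0 <= \int[leb]_(u in `]0, c]) Num.max 0 (psi u - eta).
  by apply: Rintegral_ge0 => u _; rewrite le_max lexx.
rewrite -[\int[leb]_(u in `]c, 1]) Num.max 0 (psi u - eta)]/(tail_int _ c); lra.
Qed.
End mono01.

(** * Supporting functionals *)

Section supporting_functional.
Context {R : realType}.
Implicit Types (f g phi psi : R -> R).

(** The functions on [0,1] dominated by a multiple of [a |-> 1 - a], the tail
    integral of the constant 1. *)
Definition tail_like : set (R -> R) :=
  [set f | exists M, forall a, 0 <= a <= 1 -> `|f a| <= M * (1 - a)].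

Lemma tail_like_lin f g (a b : R) : tail_like f -> tail_like g ->
  tail_like (fun x => a * f x + b * g x).
Proof.
move=> [M hM] [N hN]; exists (`|a| * M + `|b| * N) => x x01.
rewrite (le_trans (ler_normD _ _))// !normrM mulrDl lerD// -mulrA.
  by rewrite ler_wpM2l// hM.
by rewrite ler_wpM2l// hN.
Qed.

Lemma tail_like_tail_int phi : mono01 phi -> tail_like (tail_int phi).
Proof.
move=> mphi; have [[M hM] _] := mphi; exists M => a a01;
  have /andP[a0 a1] := a01.
rewrite ler_norml -mulNr -!tail_int_cst//; apply/andP; split;
  apply: le_tail_int => //;
  try exact: mono01_cst; by move=> u /hM; rewrite ler_norml => /andP[].
Qed.

(** Normalized positive linear functionals on the space [tail_like]. *)
Definition tail_functional (L : (R -> R) -> R) : Prop :=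
  [/\ forall f g (a b : R), tail_like f -> tail_like g ->
        L (fun x => a * f x + b * g x) = a * L f + b * L g,
      forall f, tail_like f -> (forall a, 0 <= a <= 1 -> 0 <= f a) -> 0 <= L f
    & L (fun a => 1 - a) = 1].

(** A convex translation equivariant functional that is monotone in the tail
    integral is supported at each point by a functional of the tail integral. *)
Lemma supporting_functional (r : (R -> R) -> R) phi0 :
  (forall phi psi, mono01 phi -> mono01 psi ->
    (forall a, 0 <= a <= 1 -> tail_int phi a <= tail_int psi a) ->
      r phi <= r psi) ->
  (forall phi (c : R), mono01 phi -> r (fun u => c + phi u) = c + r phi) ->
  (forall phi psi (l : R), mono01 phi -> mono01 psi -> 0 <= l <= 1 ->
    r (fun u => l * phi u + (1 - l) * psi u) <= l * r phi + (1 - l) * r psi) ->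
  mono01 phi0 ->
  exists2 L, tail_functional L & forall phi, mono01 phi ->
    L (tail_int phi) - L (tail_int phi0) <= r phi - r phi0.
Proof.
move=> rmono rtrans rconv mphi0.
pose V : lmodType R := R -> R^o.
pose S (f : V) := [set y : R | exists t phi, [/\ 0 <= t, mono01 phi,
  forall a, 0 <= a <= 1 -> f a <= t * (tail_int phi a - tail_int phi0 a) &
  y = t * (r phi - r phi0)]].
(* p is the directional derivative of r at phi0, extended to all tail-like
   functions by monotonicity *)
pose p f := inf (S f).
have mshift c : mono01 (fun u => c + phi0 u).
  have := mono01_lin (mono01_cst c) mphi0 ler01 ler01.
  by congr mono01; apply/funext => u; rewrite !mul1r.
have shiftE c a : 0 <= a <= 1 ->
    tail_int (fun u => c + phi0 u) a = c * (1 - a) + tail_int phi0 a.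
  move=> a01; have /andP[a0 _] := a01.
  rewrite -tail_int_cst// -[X in X + _]mul1r -[X in _ + X]mul1r.
  rewrite -tail_int_lin//; last exact: mono01_cst.
  by congr tail_int; apply/funext => u; rewrite !mul1r.
have Sne f : tail_like f -> S f !=set0.
  move=> [M hM]; exists M; exists 1, (fun u => M + phi0 u); split => //.
    move=> a a01; rewrite shiftE// addrK mul1r.
    by apply: le_trans (hM a a01); exact: ler_norm.
  by rewrite rtrans// addrK mul1r.
have Slb f M : (forall a, 0 <= a <= 1 -> `|f a| <= M * (1 - a)) ->
  lbound (S f) (- M).
  move=> hM _ [t [phi [t0 mphi fphi ->]]].
  have M0 : 0 <= M.
    by have := hM 0; rewrite lexx ler01 subr0 mulr1 => /(_ isT);
      apply: le_trans.
  have [->|tN0] := eqVneq t 0; first by rewrite mul0r oppr_le0.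
  have {t0 tN0}t0 : 0 < t by rewrite lt_neqAle eq_sym tN0.
  rewrite mulrC -ler_pdivrMr//.
  have := rmono (fun u => - M / t + phi0 u) phi (mshift _) mphi.
  rewrite rtrans// => h; rewrite lerBrDr; apply: h => a a01.
  rewrite shiftE// -lerBrDr -(ler_pM2l t0); apply: le_trans (fphi a a01).
  rewrite mulrA mulrCA divff ?gt_eqF// mulr1 mulNr.
  by have := hM a a01; rewrite ler_norml => /andP[].
have Sinf f : tail_like f -> has_inf (S f).
  by move=> Bf; split; [exact: Sne|have [M hM] := Bf; exists (- M); exact: Slb].
have p_le f t phi : tail_like f -> 0 <= t -> mono01 phi ->
    (forall a, 0 <= a <= 1 -> f a <= t * (tail_int phi a - tail_int phi0 a)) ->
    p f <= t * (r phi - r phi0).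
  move=> Bf t0 mphi h; apply: ge_inf; first by case: (Sinf f Bf).
  by exists t, phi.
have BD (f g : V) : tail_like f -> tail_like g -> tail_like (f + g).
  move=> Bf Bg; have := tail_like_lin 1 1 Bf Bg; congr tail_like.
  by apply/funext => u; rewrite !mul1r.
have BZ (a : R) (f : V) : tail_like f -> tail_like (a *: f).
  move=> Bf; have := tail_like_lin a 0 Bf Bf; congr tail_like.
  by apply/funext => u; rewrite mul0r addr0.
have B0 : tail_like (0 : V).
  by exists 0 => a _; rewrite normr0 mul0r.
have addE (f g : V) (a : R) : (f + g) a = (f a : R) + (g a : R) :> R by [].
have scaleE (c : R) (f : V) (a : R) : (c *: f) a = c * (f a : R) :> R by [].
have sp : sublinear_on (tail_like : set V) p.
  split=> [f g Bf Bg|s f s0 Bf].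
    rewrite -lerBlDr; apply: (@lb_le_inf _ (S f)); first by case: (Sinf f Bf).
    move=> _ [t1 [phi1 [t10 mphi1 h1 ->]]]; rewrite lerBlDr -lerBlDl.
    apply: (@lb_le_inf _ (S g)); first by case: (Sinf g Bg).
    move=> _ [t2 [phi2 [t20 mphi2 h2 ->]]]; rewrite lerBlDl.
    have [t0|tN0] := eqVneq (t1 + t2) 0.
      have t1E : t1 = 0 by lra.
      have t2E : t2 = 0 by lra.
      rewrite t1E t2E !mul0r addr0 -(mul0r (r phi0 - r phi0));
        apply: p_le => // [|a a01].
        exact: BD.
      by have := h1 a a01; have := h2 a a01; rewrite t1E t2E !mul0r addE => ? ?;
        lra.
    have t0 : 0 < t1 + t2 by rewrite lt_neqAle eq_sym tN0 addr_ge0.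
    pose l := t1 / (t1 + t2).
    have tl : (t1 + t2) * l = t1 by rewrite /l mulrC divfK.
    have tl' : (t1 + t2) * (1 - l) = t2 by rewrite mulrBr mulr1 tl; ring.
    have l01 : 0 <= l <= 1.
      by rewrite /l divr_ge0 ?(ltW t0)//= ler_pdivrMr// mul1r lerDl.
    have /andP[l0 l1] := l01.
    have l1' : 0 <= 1 - l by lra.
    have mphi := mono01_lin mphi1 mphi2 l0 l1'.
    apply: (@le_trans _ _ ((t1 + t2) *
      (r (fun u => l * phi1 u + (1 - l) * phi2 u) - r phi0))).
      apply: p_le => //; [exact: BD|exact: ltW|move=> a a01].
      rewrite tail_int_lin//; last by case/andP: a01.
      have -> : (t1 + t2) * (l * tail_int phi1 a +
        (1 - l) * tail_int phi2 a - tail_int phi0 a)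
          = t1 * (tail_int phi1 a - tail_int phi0 a) +
            t2 * (tail_int phi2 a - tail_int phi0 a).
        transitivity ((t1 + t2) * l * tail_int phi1 a +
            (t1 + t2) * (1 - l) * tail_int phi2 a - (t1 + t2) * tail_int phi0
              a); first by ring.
        by rewrite tl tl'; ring.
      by rewrite addE lerD// ?h1 ?h2.
    have := rconv phi1 phi2 l mphi1 mphi2 l01.
    rewrite -(ler_pM2l t0) mulrDr (mulrA _ l) (mulrA _ (1 - l)) tl tl' => h;
      rewrite mulrBr; lra.
  rewrite mulrC -ler_pdivrMr//; apply: (@lb_le_inf _ (S f)).
    by case: (Sinf f Bf).
  move=> _ [t [phi [t0 mphi h ->]]]; rewrite ler_pdivrMr// mulrC mulrA.
  apply: p_le => //; [exact: BZ|by rewrite mulr_ge0// ltW|move=> a a01].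
  by rewrite -mulrA scaleE ler_pM2l// h.
have [L [LD LZ Lp]] := hahn_banach B0 BD BZ sp.
have Llin f g (a b : R) : tail_like f -> tail_like g ->
    L (fun x => a * f x + b * g x) = a * L f + b * L g.
  by move=> Bf Bg; rewrite -!LZ// -LD//; exact: BZ.
have Lle f : tail_like f -> (forall a, 0 <= a <= 1 -> f a <= 0) -> L f <= 0.
  move=> Bf f0; apply: le_trans (Lp f Bf) _.
  rewrite -(mul0r (r phi0 - r phi0)); apply: p_le => // a a01.
  by rewrite mul0r f0.
have LN f : tail_like f -> L (fun a => - f a) = - L f.
  move=> Bf; have := Llin f f (-1) 0 Bf Bf; rewrite mulN1r mul0r addr0 => <-.
  by congr L; apply/funext => a; rewrite mulN1r mul0r addr0.
have Bone : tail_like (fun a => 1 - a).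
  by exists 1 => a a01; rewrite mul1r ger0_norm//; lra.
have BN f : tail_like f -> tail_like (fun a => - f a).
  move=> Bf; have := tail_like_lin (-1) 0 Bf Bf; congr tail_like.
  by apply/funext => a; rewrite mulN1r mul0r addr0.
have Lone c : L (fun a => c * (1 - a)) <= c.
  have Bc : tail_like (fun a => c * (1 - a)).
    have := tail_like_lin c 0 Bone Bone; congr tail_like.
    by apply/funext => a; rewrite mul0r addr0.
  apply: le_trans (Lp _ Bc) _.
  have := @p_le (fun a => c * (1 - a)) 1 (fun u => c + phi0 u) Bc ler01
    (mshift c).
  rewrite rtrans// addrK mul1r; apply => a a01.
  by rewrite shiftE// mul1r addrK.
exists L.
  split => // [f Bf f0|].
    have := Lle _ (BN _ Bf); rewrite LN// => h.
    by rewrite -oppr_le0; apply: h => a a01; rewrite oppr_le0 f0.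
  apply/eqP; rewrite eq_le; apply/andP; split.
    have := Lone 1; rewrite (_ : (fun a => 1 * (1 - a)) = fun a => 1 - a)//.
    by apply/funext => a; rewrite mul1r.
  have := Lone (-1); rewrite (_ : (fun a => -1 * (1 - a)) = fun a => - (1 - a)).
    by rewrite LN// lerN2.
  by apply/funext => a; rewrite mulN1r.
move=> phi mphi.
have B1 := tail_like_tail_int mphi; have B2 := tail_like_tail_int mphi0.
have <- : L (fun a => 1 * tail_int phi a + (-1) * tail_int phi0 a) =
    L (tail_int phi) - L (tail_int phi0) by rewrite Llin// mul1r mulN1r.
have B3 := tail_like_lin 1 (-1) B1 B2.
apply: le_trans (Lp _ B3) _.
rewrite -[leRHS]mul1r; apply: p_le => // a a01.
by rewrite !mul1r mulN1r.
Qed.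

End supporting_functional.

(** * Staircase approximation *)

Section staircases.
Context {R : realType}.
Implicit Types (phi psi : R -> R) (I : (R -> R) -> R).

(** The strict upper level sets on (0,1] are of the form (q,1]: this holds for
    nondecreasing left-continuous functions. *)
Definition level01 phi := forall eta, exists2 q, 0 <= q <= 1 &
  forall p, 0 < p <= 1 -> (eta < phi p) = (q < p).

(** The step function with bottom value [c] that jumps by [h] after each of the
    points [q k], [k < n]. *)
Definition staircase (c h : R) (q : nat -> R) n (p : R) :=
  c + \sum_(k < n) h * step (q k) p.

Lemma staircaseS c h q n : staircase c h q n.+1 =
  fun p => 1 * staircase c h q n p + h * step (q n) p.
Proof. by apply/funext => p; rewrite mul1r /staircase big_ord_recr/= addrA. Qed.

Lemma staircase0 c h q : staircase c h q 0 = fun=> c.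
Proof. by apply/funext => p; rewrite /staircase big_ord0 addr0. Qed.

Lemma mono01_staircase c h q n : 0 <= h -> mono01 (staircase c h q n).
Proof.
move=> h0; elim: n => [|n IH]; first by rewrite staircase0; exact: mono01_cst.
by rewrite staircaseS; apply: mono01_lin => //; exact: mono01_step.
Qed.

(** [h] times the number of multiples of [h] below [y], counting 0, exceeds [y]
    by at most [h]. *)
Lemma count_levels (h y : R) n : 0 <= h -> 0 <= y <= n%:R * h ->
  y <= \sum_(k < n) h * (k%:R * h < y)%R%:R <= y + h.
Proof.
move=> h0; elim: n => [|n IH].
  by rewrite mul0r big_ord0 => /le_anti <-; rewrite lexx add0r h0.
move=> /andP[y0 yn]; rewrite big_ord_recr/=.
have [yn'|ny] := leP y (n%:R * h).
  by rewrite mulr0 addr0; apply: IH; rewrite y0.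
rewrite (eq_bigr (fun=> h)); last first.
  move=> k _; rewrite (_ : (_ < _) = true) ?mulr1//; apply: le_lt_trans ny.
  by rewrite ler_wpM2r// ler_nat ltnW.
rewrite big_const_ord iter_addr_0 mulr1 -[h *+ n]mulr_natl.
by rewrite -[n.+1%:R]natr1 in yn; lra.
Qed.

Lemma staircase_approx phi (e : R) : bounded01 phi -> level01 phi -> 0 < e ->
  exists c h q n, [/\ 0 <= h, forall k, 0 <= q k <= 1 &
    forall p, 0 < p <= 1 -> phi p <= staircase c h q n p <= phi p + e].
Proof.
move=> [M hM] lphi e0.
have M0 : 0 <= M by have := hM 1; rewrite ltr01 lexx => /(_ isT);
  apply: le_trans.
pose n := (Num.truncn ((M + M) / e)).+1.
have ne : (M + M) / e <= n%:R by exact/ltW/truncnS_gt.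
have /choice[q qP] : forall k : nat, exists q, 0 <= q <= 1 /\
    forall p, 0 < p <= 1 -> (- M + k%:R * e < phi p) = (q < p).
  by move=> k; have [q q01 h] := lphi (- M + k%:R * e); exists q.
exists (- M), e, q, n; split => [||p p01];
  [exact: ltW|by move=> k; case: (qP k)|].
have : 0 <= phi p + M <= n%:R * e.
  have := hM p p01; rewrite ler_norml -ler_pdivrMr// => /andP[h1 h2].
  apply/andP; split; first lra.
  by apply: le_trans ne; rewrite ler_pM2r ?invr_gt0//; lra.
move=> /(count_levels (ltW e0)) /andP[h1 h2].
have E : \sum_(k < n) e * step (q k) p =
  \sum_(k < n) e * (k%:R * e < phi p + M)%R%:R.
  by apply: eq_bigr => k _; rewrite /step -(qP k).2// -ltrBlDr [_ - M]addrC.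
by rewrite /staircase E; lra.
Qed.

(** A monotone functional, linear on combinations with nonnegative
    coefficients, on bounded nondecreasing functions. *)
Definition mono_functional I := [/\
  forall phi psi (a b : R), mono01 phi -> mono01 psi -> 0 <= a -> 0 <= b ->
    I (fun u => a * phi u + b * psi u) = a * I phi + b * I psi,
  forall phi psi, mono01 phi -> mono01 psi ->
    (forall u, 0 < u <= 1 -> phi u <= psi u) -> I phi <= I psi &
  forall c, I (fun=> c) = c].

(** Such a functional is determined by its values on the indicator functions of
    the intervals (q,1], since these generate the staircases. *)
Lemma mono_functional_ext I1 I2 : mono_functional I1 -> mono_functional I2 ->
  (forall q : R, 0 <= q <= 1 -> I1 (step q) = I2 (step q)) ->
  forall phi, mono01 phi -> level01 phi -> I1 phi = I2 phi.
Proof.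
wlog suff le12 : I1 I2 / mono_functional I1 -> mono_functional I2 ->
  (forall q : R, 0 <= q <= 1 -> I1 (step q) = I2 (step q)) ->
  forall phi, mono01 phi -> level01 phi -> I1 phi <= I2 phi.
  move=> m1 m2 e12 phi mphi lphi; apply/eqP; rewrite eq_le !le12// => q q01.
  by rewrite e12.
move=> [lin1 le1 cst1] [lin2 le2 cst2] e12 phi mphi lphi.
apply/ler_addgt0Pr => e e0.
have [c [h [q [n [h0 q01 s]]]]] := staircase_approx mphi.1 lphi e0.
have ms := mono01_staircase c q n h0.
apply: (@le_trans _ _ (I1 (staircase c h q n))).
  by apply: le1 => // u /s /andP[].
have -> : I1 (staircase c h q n) = I2 (staircase c h q n).
  elim: n {s ms} => [|n IH]; first by rewrite staircase0 cst1 cst2.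
  rewrite staircaseS lin1 ?lin2//; last 4 first.
  - exact: mono01_staircase.
  - exact: mono01_step.
  - exact: mono01_staircase.
  - exact: mono01_step.
  by rewrite IH e12.
apply: (@le_trans _ _ (I2 (fun u => 1 * phi u + 1 * e))).
  apply: le2 => //; first by apply: mono01_lin => //; exact: mono01_cst.
  by move=> u /s /andP[_]; rewrite !mul1r.
by rewrite (lin2 phi (fun=> e) 1 1)// ?cst2 ?mul1r//; exact: mono01_cst.
Qed.

End staircases.

(** * The distortion represented by a tail functional *)

Section meas01_integral.
Context {R : realType}.
Implicit Types (mu : meas01 R) (phi : R -> R).

Lemma meas01_itv_fin mu : (mu `]0%R, 1%R]%classic < +oo)%E.
Proof. by rewrite -ge0_fin_numE// fin_num_measure. Qed.

Lemma integrable_meas01_bounded mu phi : bounded01 phi ->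
  measurable_fun (`]0%R, 1%R] : set R) phi ->
    mu.-integrable `]0, 1] (EFin \o phi).
Proof.
move=> [M hM] mphi; apply: measurable_bounded_integrable => //=.
  exact: meas01_itv_fin.
exists M; split; first exact: num_real.
by move=> N MN x /=; rewrite in_itv/= => /hM /le_trans; apply; exact: ltW.
Qed.

Lemma integrable_meas01 mu phi : mono01 phi ->
  mu.-integrable `]0, 1] (EFin \o phi).
Proof.
by move=> mphi; apply: integrable_meas01_bounded;
  [case: mphi|exact: measurable_mono01].
Qed.

Lemma meas01_mono_functional mu : mu `]0%R, 1%R]%classic = 1%E ->
  mono_functional (fun phi => \int[mu]_(p in `]0, 1]) phi p).
Proof.
move=> mu1; split => [phi psi a b mphi mpsi a0 b0|phi psi mphi mpsi h|c].
- have i1 := integrable_meas01 mu mphi; have i2 := integrable_meas01 mu mpsi.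
  by apply: Rintegral_lincomb => //; exact: measurable_itv.
- apply: le_Rintegral => //; exact: integrable_meas01.
- by rewrite Rintegral_cst//= mu1 mulr1.
Qed.

End meas01_integral.

Lemma convex_function01P (R : realType) (f : R -> R) :
  convex_function (`]0%R, 1%R]%classic : set R) f <->
  forall x y l, 0 < x <= 1 -> 0 < y <= 1 -> 0 <= l <= 1 ->
    f (l * x + (1 - l) * y) <= l * f x + (1 - l) * f y.
Proof.
split=> [cf x y l x01 y01 /andP[l0 l1]|h t x y].
  by have := cf (Itv01 l0 l1) x y; rewrite !inE/= !in_itv/=; apply.
rewrite !inE/= !in_itv/= => x01 y01.
by apply: h => //; rewrite ge0 le1.
Qed.

Section measure_of_tail_functional.
Context {R : realType}.
Variable L : (R -> R) -> R.
Hypothesis HL : tail_functional L.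

Let Llin f g (a b : R) : tail_like f -> tail_like g ->
  L (fun x => a * f x + b * g x) = a * L f + b * L g.
Proof. by case: HL => h _ _; exact: h. Qed.

Let Lle f g : tail_like f -> tail_like g ->
  (forall a, 0 <= a <= 1 -> f a <= g a) -> L f <= L g.
Proof.
case: HL => lin pos _ Bf Bg fg; rewrite -subr_ge0.
have <- : L (fun a => 1 * g a + (-1) * f a) = L g - L f.
  by rewrite lin// mul1r mulN1r.
apply: pos; first exact: tail_like_lin.
by move=> a a01; rewrite mul1r mulN1r subr_ge0 fg.
Qed.

Let Leq f g : tail_like f -> tail_like g ->
  (forall a, 0 <= a <= 1 -> f a = g a) -> L f = L g.
Proof.
by move=> Bf Bg fg; apply/eqP; rewrite eq_le !Lle// => a a01; rewrite fg.
Qed.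

Lemma tail_mono_functional : mono_functional (fun phi => L (tail_int phi)).
Proof.
split => [phi psi a b mphi mpsi a0 b0|phi psi mphi mpsi h|c].
- have B1 := tail_like_tail_int mphi; have B2 := tail_like_tail_int mpsi.
  rewrite -Llin//; apply: Leq.
  + exact/tail_like_tail_int/mono01_lin.
  + exact: tail_like_lin.
  + by move=> t /andP[t0 _]; rewrite tail_int_lin.
- apply: Lle; [exact: tail_like_tail_int|exact: tail_like_tail_int|].
  by move=> a /andP[a0 _]; exact: le_tail_int.
- have B1 : tail_like (fun a : R => 1 - a).
    by exists 1 => a a01; rewrite mul1r ger0_norm//; lra.
  transitivity (L (fun a => c * (1 - a) + 0 * (1 - a))).
    apply: Leq; first exact/tail_like_tail_int/mono01_cst.
      exact: tail_like_lin.
    by move=> a a01; rewrite tail_int_cst// mul0r addr0.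
  by rewrite Llin//; case: HL => _ _ ->; rewrite mulr1 mul0r addr0.
Qed.

Let clamp (q : R) := Num.max 0 (Num.min q 1).

Let clamp01 q : 0 <= clamp q <= 1.
Proof. by rewrite /clamp le_max lexx/= ge_max ler01 ge_min lexx orbT. Qed.

Let clamp_id q : 0 <= q <= 1 -> clamp q = q.
Proof. by move=> /andP[q0 q1]; rewrite /clamp (min_l q1) (max_r q0). Qed.

(** [G q] is the mass of (q,1] under the measure to be constructed, and [F] the
    distribution function, extended to the line by constants. *)
Let G (q : R) := L (tail_int (step q)).

Let F (q : R) : R := 1 - G (clamp q).

Let Bstep (q : R) : tail_like (tail_int (step q)).
Proof. exact/tail_like_tail_int/mono01_step. Qed.

Let G_concave x y l : 0 <= x <= 1 -> 0 <= y <= 1 -> 0 <= l <= 1 ->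
  l * G x + (1 - l) * G y <= G (l * x + (1 - l) * y).
Proof.
move=> x01 y01 l01; rewrite -Llin//; apply: Lle;
  [exact: tail_like_lin|exact: Bstep|].
move=> a a01; have xy01 : 0 <= l * x + (1 - l) * y <= 1 by apply/andP; split;
  nra.
rewrite !tail_int_step//.
suff : Num.max a (l * x + (1 - l) * y) <= l * Num.max a x +
  (1 - l) * Num.max a y by lra.
have [l0 l1] := andP l01; have l1' : 0 <= 1 - l by lra.
have h1 : l * a <= l * Num.max a x by rewrite ler_wpM2l// le_max lexx.
have h2 : l * x <= l * Num.max a x by rewrite ler_wpM2l// le_max lexx orbT.
have h3 : (1 - l) * a <= (1 - l) * Num.max a y by rewrite ler_wpM2l// le_max
  lexx.
have h4 : (1 - l) * y <= (1 - l) * Num.max a y by rewrite ler_wpM2l// le_max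
  lexx orbT.
by rewrite ge_max; apply/andP; split; lra.
Qed.

Let G0 : G 0 = 1.
Proof.
have [_ _ h] := tail_mono_functional; rewrite -[RHS]h /G; apply: Leq => //.
  exact/tail_like_tail_int/mono01_cst.
by move=> a a01; rewrite tail_int_step ?lexx ?ler01// tail_int_cst// mul1r
  max_l//; case/andP: a01.
Qed.

Let G1 : G 1 = 0.
Proof.
have [_ _ h] := tail_mono_functional; rewrite -[RHS]h /G; apply: Leq => //.
  exact/tail_like_tail_int/mono01_cst.
by move=> a a01; rewrite tail_int_step ?lexx ?ler01// tail_int_cst// mul0r max_r
  ?subrr//; case/andP: a01.
Qed.

Let G_noninc x y : 0 <= x -> x <= y -> y <= 1 -> G y <= G x.
Proof.
move=> x0 xy y1; have [_ h _] := tail_mono_functional.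
apply: h; [exact: mono01_step|exact: mono01_step|move=> u _].
by rewrite ler_nat; case: (ltP y u) => // yu; rewrite (le_lt_trans xy yu).
Qed.

Let F_nd : nondecreasing F.
Proof.
move=> x y xy; rewrite /F lerD2l lerN2.
have /andP[x0 x1] := clamp01 x; have /andP[y0 y1] := clamp01 y.
apply: G_noninc => //; rewrite /clamp ge_max !le_max lexx/=; apply/orP; right.
by rewrite le_min !ge_min xy lexx !orbT.
Qed.

Let F_id q : 0 <= q <= 1 -> F q = 1 - G q.
Proof. by move=> q01; rewrite /F clamp_id. Qed.

(** On [0,1), concavity of [G] bounds the slope of [F] to the right of [q] by
    that of the chord from [q] to 1. *)
Let F_rlip q : exists K d : R, [/\ 0 <= K, 0 < d &
  forall h, 0 < h -> h < d -> F (q + h) <= F q + K * h].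
Proof.
have [q0|q0] := ltP q 0.
  exists 0, (- q); split; rewrite ?oppr_gt0// => h h0 hq;
    rewrite mul0r addr0 /F /clamp.
  by rewrite !max_l// ge_min; apply/orP; left; lra.
have [q1|q1] := leP 1 q.
  exists 0, 1; split => // h h0 h1; rewrite mul0r addr0 /F /clamp.
  by rewrite !min_r//; lra.
have q10 : 0 < 1 - q by rewrite subr_gt0.
exists (1 - q)^-1, (1 - q); split => // [|h h0 hq];
  first by rewrite invr_ge0 ltW.
rewrite !F_id; [|lra|lra].
(* q + h as a convex combination of q and 1 *)
pose l := 1 - h / (1 - q).
have hl : h / (1 - q) = 1 - l by rewrite /l; ring.
have l01 : 0 <= l <= 1.
  by rewrite /l subr_ge0 gerBl divr_ge0 ?(ltW h0) ?(ltW q10)// ler_pdivrMr//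
    mul1r ltW.
have := @G_concave q 1 l; rewrite G1 mulr0 addr0.
have -> : l * q + (1 - l) * 1 = q + h.
  rewrite mulr1; have : h = (1 - l) * (1 - q) by rewrite -hl divfK ?gt_eqF.
  by move=> ->; ring.
have Gq1 : G q <= 1 by rewrite -G0 G_noninc// ltW.
have q01 : 0 <= q <= 1 by rewrite q0 ltW.
move=> /(_ q01); rewrite lexx ler01 => /(_ isT l01) h1.
by rewrite [_^-1 * h]mulrC hl; have := andP l01 => -[l0 l1]; nra.
Qed.

Let F_rc : right_continuous F.
Proof.
move=> q; have [K [d [K0 d0 h]]] := F_rlip q.
apply/cvgrPdist_le => e e0; near=> x.
have qx : q < x by near: x; exact: nbhs_right_gt.
have xd : x < q + d by near: x; apply: nbhs_right_lt; rewrite ltrDl.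
have xe : x < q + e / (K + 1).
  by near: x; apply: nbhs_right_lt; rewrite ltrDl divr_gt0//; lra.
rewrite distrC ger0_norm ?subr_ge0 ?F_nd ?ltW//.
have hx : F x <= F q + K * (x - q).
  by have := h (x - q) ltac:(by rewrite subr_gt0) ltac:(lra); rewrite subrKC.
rewrite ltrBlDl; apply: (le_lt_trans hx).
rewrite ltrD2l.
have : (x - q) * (K + 1) < e by rewrite -ltr_pdivlMr; lra.
by nra.
Unshelve. all: by end_near. Qed.

HB.instance Definition _ := isCumulative.Build R _ R F F_nd F_rc.

Let LS := lebesgue_stieltjes_measure F.

Let LS_oc (a b : R) : a <= b -> LS `]a, b]%classic = (F b - F a)%:E.
Proof.
move=> ab; rewrite /LS /lebesgue_stieltjes_measure /measure_extension/=.
by rewrite measurable_mu_extE/= ?wlength_itv_bnd//; exact: is_ocitv.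
Qed.

Let mI : measurable (`]0%R, 1%R]%classic : set (measurableTypeR R)).
Proof. exact: measurable_itv. Qed.

Let LS_fin : (LS `]0%R, 1%R]%classic < +oo)%E.
Proof. by rewrite LS_oc// ltry. Qed.

Let nu : {finite_measure set (measurableTypeR R) -> \bar R} :=
  mfrestr mI LS_fin.

Let nu0 : nu (~` `]0%R, 1%R]%classic) = 0%E.
Proof. by rewrite /nu/= /mfrestr /mrestr setICl measure0. Qed.

Let mu : meas01 R := exist _ nu nu0.

Let mu_oc (a b : R) : 0 <= a -> a <= b -> b <= 1 ->
  mu `]a, b]%classic = (F b - F a)%:E.
Proof.
move=> a0 ab b1; rewrite /mu/= /mval/= /mfrestr /mrestr setIidl;
  first exact: LS_oc.
move=> x /=; rewrite !in_itv/=; lra.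
Qed.

Let F0 : F 0 = 0. Proof. by rewrite F_id ?lexx ?ler01// G0 subrr. Qed.
Let F1 : F 1 = 1. Proof. by rewrite F_id ?lexx ?ler01// G1 subr0. Qed.

Let cdfE p : 0 <= p <= 1 -> cdf01 mu p = F p.
Proof. by move=> /andP[p0 p1]; rewrite /cdf01 mu_oc// F0 subr0. Qed.

Let mu_distortion : distortions mu.
Proof.
split.
- move=> p q; rewrite !in_itv/= => /andP[p0 p1] /andP[q0 q1] pq.
  by rewrite !cdfE ?F_nd ?p1 ?q1 ?(ltW p0) ?(ltW q0).
- apply/convex_function01P => x y l x01 y01 l01.
  have [x0 x1] := andP x01; have [y0 y1] := andP y01; have [l0 l1] := andP l01.
  have xc : 0 <= x <= 1 by rewrite x1 ltW.
  have yc : 0 <= y <= 1 by rewrite y1 ltW.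
  have xyc : 0 <= l * x + (1 - l) * y <= 1 by apply/andP; split; nra.
  rewrite !cdfE// !F_id//.
  by have := G_concave xc yc l01; lra.
- by rewrite mu_oc// F1 F0 subr0.
Qed.

(** Every normalized positive functional of the tail integral is, on functions
    with left-open level sets, integration against a distortion. *)
Lemma measure_of_tail_functional : exists2 nu : meas01 R, distortions nu &
  forall phi, mono01 phi -> level01 phi ->
    L (tail_int phi) = \int[nu]_(p in `]0, 1]) phi p.
Proof.
exists mu => //.
apply: (@mono_functional_ext _ (fun phi => L (tail_int phi))
  (fun phi => \int[mu]_(p in `]0, 1]) phi p)).
- exact: tail_mono_functional.
- by apply: meas01_mono_functional; case: mu_distortion.
move=> q q01; have /andP[q0 q1] := q01.
rewrite [in RHS]stepE /Rintegral integral_indic//.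
have -> : `]q, +oo[ `&` `]0, 1] = `]q, 1]%classic :> set R.
  by apply/seteqP; split=> u /=; rewrite !in_itv/= andbT; lra.
rewrite [X in fine X]mu_oc// F1 F_id//=.
by rewrite opprB addrC subrK.
Qed.

End measure_of_tail_functional.

(** * Weak topology and convexity of distribution functions *)

Lemma ptws_eval_continuous (U : Type) (V : topologicalType) (u : U) :
  continuous (fun h : {ptws U -> V} => h u).
Proof.
move=> h; have /cvg_sup/(_ u) hu : nbhs (h : {ptws U -> V}) -->
  (h : {ptws U -> V}) by [].
by apply: cvg_trans (cvg_app _ hu) _; exact: initial_continuous.
Qed.

Section weak_topology.
Context {R : realType}.
Implicit Types (mu nu kappa : meas01 R) (f g phi : R -> R).

Lemma continuous_pairing f : continuous f -> bounded01 f ->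
  continuous (fun mu : meas01 R => \int[mu]_(p in `]0, 1]) f p : R).
Proof.
move=> cf [M hM].
have fP : {within `]0%R, 1%R], continuous f} /\
  [bounded f p | p in `]0%R, 1%R]].
  split; first exact: continuous_subspaceT.
  exists M; split; first exact: num_real.
  by move=> N MN x /=; rewrite in_itv/= => /hM /le_trans; apply; exact: ltW.
pose ff : bcont01 R := exist _ f fP.
move=> mu.
apply: (@continuous_comp (meas01 R) {ptws bcont01 R -> R} R (@bcont01_pairing R)
  (fun h => h ff)).
  exact: (@initial_continuous _ {ptws bcont01 R -> R} (@bcont01_pairing R)).
exact: ptws_eval_continuous.
Qed.

Lemma closed_pairing_le f (c : R) : continuous f -> bounded01 f ->
  closed [set mu : meas01 R | \int[mu]_(p in `]0, 1]) f p <= c].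
Proof.
move=> cf bf; apply: (@closed_comp _ _ _ [set y : R | y <= c]);
  last exact: closed_le.
by move=> mu _; exact: continuous_pairing.
Qed.

Lemma closed_pairing_eq f (c : R) : continuous f -> bounded01 f ->
  closed [set mu : meas01 R | \int[mu]_(p in `]0, 1]) f p = c].
Proof.
move=> cf bf; apply: (@closed_comp _ _ _ [set y : R | y = c]);
  last exact: closed_eq.
by move=> mu _; exact: continuous_pairing.
Qed.

Lemma cdf01_le mu p q : p <= q -> cdf01 mu p <= cdf01 mu q.
Proof.
move=> pq; rewrite /cdf01 fine_le ?fin_num_measure//.
by apply: le_measure; rewrite ?inE//; apply: subset_itvl; rewrite bnd_simp.
Qed.

(** Right-continuity of the distribution function. *)
Lemma cdf01_right mu t (e : R) : 0 < e -> exists2 d, 0 < d &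
  cdf01 mu (t + d) <= cdf01 mu t + e.
Proof.
move=> e0; pose S n := `]0, t + n.+1%:R^-1]%classic : set R.
have SE : `]0, t]%classic = \bigcap_n S n.
  apply/seteqP; split=> x /=.
    by rewrite in_itv/= => /andP[x0 xt] n _;
      rewrite /S /= in_itv/= x0 (le_trans xt)// lerDl.
  move=> Sx; have := Sx 0%N I; rewrite /S /= !in_itv/= => /andP[-> _] /=.
  apply/ler_addgt0Pr => d d0.
  have := Sx (Num.truncn d^-1) I; rewrite /S /= in_itv/= => /andP[_ h].
  by apply: le_trans h _; rewrite lerD2l invf_ple ?posrE//;
    exact/ltW/truncnS_gt.
have : mu (S n) @[n --> \oo] --> mu (\bigcap_n S n).
  apply: nonincreasing_cvg_mu => //.
  - by rewrite -ge0_fin_numE// fin_num_measure//; exact: measurable_itv.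
  - by move=> n; exact: measurable_itv.
  - by apply: bigcapT_measurable => n; exact: measurable_itv.
  - apply/nonincreasing_seqP => n; apply/subsetPset; apply: subset_itvl.
    by rewrite bnd_simp lerD2l lef_pV2 ?posrE// ler_nat.
rewrite -SE -[mu `]0, t]%classic]fineK ?fin_num_measure//.
move=> /fine_cvg /cvgrPdist_le/(_ e e0)[n _ /(_ n (leqnn _))/= h].
exists n.+1%:R^-1; first by rewrite invr_gt0.
have := ler_norm (cdf01 mu (t + n.+1%:R^-1) - cdf01 mu t); rewrite distrC.
move=> /le_trans /(_ h); rewrite lerBlDl; apply.
Qed.

(** For [t > 1] both sides are the total mass. *)
Lemma cdf01E mu t : cdf01 mu t = \int[mu]_(p in `]0, 1]) \1_(`]-oo, t]) p.
Proof.
rewrite /Rintegral integral_indic//=.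
congr fine; have mu0 : mu (~` `]0, 1]%classic) = 0%E := svalP mu.
have mI (i : interval R) : measurable ([set` i] : set (measurableTypeR R)).
  exact: measurable_itv.
have -> : `]-oo, t] `&` `]0, 1] = `]0, t] `&` `]0, 1]%classic :> set R.
  apply/seteqP; split=> u /=; rewrite !in_itv/=.
    by move=> [h1 /andP[h2 h3]]; rewrite h1 h2 h3.
  by move=> [/andP[h1 h2] h3].
rewrite [LHS](measureDI _ (mI `]0, t]) (mI `]0, 1])).
rewrite [X in (X + _)%E](_ : _ = 0%E) ?add0e//.
apply: subset_measure0 mu0; [exact: measurableD|exact: measurableC|].
by move=> u [].
Qed.

(** The continuous function equal to 1 up to [t], to 0 after [t + d], and affine
    in between. *)
Definition ramp (t d p : R) := Num.max 0 (Num.min 1 ((t + d - p) / d)).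

Lemma continuous_ramp t d : continuous (ramp t d).
Proof.
pose lin (p : R) := (t + d - p) / d.
have -> : ramp t d = (fun=> 0) \max ((fun=> 1) \min lin) by [].
move=> p; apply: continuous_max; first exact: cvg_cst.
apply: continuous_min; first exact: cvg_cst.
apply: cvgM; last exact: cvg_cst.
by apply: cvgB; [exact: cvg_cst|exact: cvg_id].
Qed.

Lemma ramp01 t d p : 0 <= ramp t d p <= 1.
Proof. by rewrite /ramp le_max lexx ge_max ler01 ge_min lexx. Qed.

Lemma ramp_ge t d p : 0 < d -> \1_(`]-oo, t]) p <= ramp t d p.
Proof.
move=> d0; rewrite indicE mem_setE in_itv/=; case: (leP p t) => pt /=;
  last by case/andP: (ramp01 t d p).
by rewrite /ramp le_max le_min lexx/= ler_pdivlMr// mul1r; apply/orP; right;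
  lra.
Qed.

Lemma ramp_le t d p : 0 < d -> ramp t d p <= \1_(`]-oo, t + d]) p.
Proof.
move=> d0; rewrite indicE mem_setE in_itv/=; case: (leP p (t + d)) => pt /=.
  by case/andP: (ramp01 t d p).
rewrite /ramp ge_max lexx/= ge_min; apply/orP; right.
by rewrite ler_pdivrMr// mul0r; lra.
Qed.

Lemma integrable_cdf01 mu t : mu.-integrable `]0, 1]
  (EFin \o (\1_(`]-oo, t]) : R -> R)).
Proof.
apply: integrable_meas01_bounded.
  by exists 1 => u _; rewrite indicE; case: (_ \in _); rewrite ?normr1 ?normr0.
exact: measurable_indic.
Qed.

Lemma integrable_continuous01 mu f : continuous f -> bounded01 f ->
  mu.-integrable `]0, 1] (EFin \o f).
Proof.
move=> cf bf; apply: integrable_meas01_bounded => //.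
by apply: measurable_funTS; exact: continuous_measurable_fun.
Qed.

Lemma bounded01_ramp t d : bounded01 (ramp t d).
Proof. by exists 1 => u _; have /andP[h1 h2] := ramp01 t d u;
  rewrite ger0_norm. Qed.

Lemma ramp_integral_ge mu t d : 0 < d ->
  cdf01 mu t <= \int[mu]_(p in `]0, 1]) ramp t d p.
Proof.
move=> d0; rewrite cdf01E; apply: le_Rintegral => //.
- exact: integrable_cdf01.
- by apply: integrable_continuous01;
  [exact: continuous_ramp|exact: bounded01_ramp].
- by move=> p _; exact: ramp_ge.
Qed.

Lemma ramp_integral_le mu t d : 0 < d ->
  \int[mu]_(p in `]0, 1]) ramp t d p <= cdf01 mu (t + d).
Proof.
move=> d0; rewrite cdf01E; apply: le_Rintegral => //.
- by apply: integrable_continuous01;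
  [exact: continuous_ramp|exact: bounded01_ramp].
- exact: integrable_cdf01.
- by move=> p _; exact: ramp_le.
Qed.

Lemma continuous_bounded_lin f g (a b : R) : continuous f -> continuous g ->
  bounded01 f -> bounded01 g -> continuous (fun p => a * f p + b * g p) /\
  bounded01 (fun p => a * f p + b * g p).
Proof.
move=> cf cg [M hM] [N hN]; split.
  move=> p; apply: cvgD; (apply: cvgM; first exact: cvg_cst);
    [exact: cf|exact: cg].
exists (`|a| * M + `|b| * N) => u u01; rewrite (le_trans (ler_normD _ _))//.
by rewrite !normrM lerD// ler_wpM2l// ?hM ?hN.
Qed.

(** The distribution function is convex on (0,1]. *)
Definition convex_cdf mu := forall x y l, 0 < x <= 1 -> 0 < y <= 1 ->
  0 <= l <= 1 ->
  cdf01 mu (l * x + (1 - l) * y) <= l * cdf01 mu x + (1 - l) * cdf01 mu y.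

(** Ramps turn the convexity inequality into a closed condition, at the price of
    a shift by [d] on both sides; the shift is then removed with
    right-continuity only. *)
Lemma closed_convex_cdf : closed convex_cdf.
Proof.
move=> mu clmu.
have key x y l d : 0 < x <= 1 -> 0 < y <= 1 -> 0 <= l <= 1 -> 0 < d ->
    cdf01 mu (l * x + (1 - l) * y - d) <= l * cdf01 mu (x + d) +
      (1 - l) * cdf01 mu (y + d).
  move=> x01 y01 l01 d0; have [l0 l1] := andP l01; have l1' : 0 <= 1 - l by lra.
  pose w := l * x + (1 - l) * y - d.
  pose g1 p := 1 * ramp w d p + (- l) * ramp x d p.
  pose g p := 1 * g1 p + (- (1 - l)) * ramp y d p.
  have [c1 b1] : continuous g1 /\ bounded01 g1.
    by apply: continuous_bounded_lin;
      [exact: continuous_ramp|exact: continuous_ramp|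
       exact: bounded01_ramp|exact: bounded01_ramp].
  have [c2 b2] : continuous g /\ bounded01 g.
    by apply: continuous_bounded_lin => //;
      [exact: continuous_ramp|exact: bounded01_ramp].
  have gE nu : \int[nu]_(p in `]0, 1]) g p = \int[nu]_(p in `]0, 1]) ramp w d p
      - l * \int[nu]_(p in `]0, 1]) ramp x d p - (1 - l) *
        \int[nu]_(p in `]0, 1]) ramp y d p.
    have ir t : nu.-integrable `]0, 1] (EFin \o ramp t d).
      by apply: integrable_continuous01;
        [exact: continuous_ramp|exact: bounded01_ramp].
    have i1 : nu.-integrable `]0, 1] (EFin \o g1).
      exact: integrable_continuous01.
    rewrite Rintegral_lincomb// mul1r Rintegral_lincomb//.
    by rewrite mul1r !mulNr.
  have := @closed_pairing_le g 0 c2 b2.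
  have sub : convex_cdf `<=`
      [set nu : meas01 R | \int[nu]_(p in `]0, 1]) g p <= 0].
    move=> nu cnu /=; rewrite gE; have := cnu x y l x01 y01 l01.
    have := ramp_integral_le nu w d0; rewrite {2}/w subrK.
    have := ler_wpM2l l0 (ramp_integral_ge nu x d0).
    have := ler_wpM2l l1' (ramp_integral_ge nu y d0); lra.
  move=> cl; have := closureS sub clmu; rewrite -(closure_id _).1//= gE.
  have := ramp_integral_ge mu w d0.
  have := ler_wpM2l l0 (ramp_integral_le mu x d0).
  have := ler_wpM2l l1' (ramp_integral_le mu y d0); rewrite /w; lra.
(* moving x to x + s with s > 0 moves the convex combination by l * s, which
   compensates the shift d = l * s on the left-hand side *)
have main x y l : 0 < x -> x < 1 -> 0 < y <= 1 -> 0 < l <= 1 ->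
    cdf01 mu (l * x + (1 - l) * y) <= l * cdf01 mu x + (1 - l) * cdf01 mu y.
  move=> x0 x1 y01 /andP[l0 l1]; have [y0 y1] := andP y01.
  apply/ler_addgt0Pr => e e0.
  have [d1 d10 h1] := cdf01_right mu x e0;
    have [d2 d20 h2] := cdf01_right mu y e0.
  pose s := Num.min (1 - x) (Num.min (d1 / 2) d2).
  have s0 : 0 < s by rewrite !lt_min subr_gt0 x1 d20 divr_gt0.
  have sx : s <= 1 - x by rewrite ge_min lexx.
  have s1 : s <= d1 / 2 by rewrite !ge_min lexx orbT.
  have s2 : s <= d2 by rewrite !ge_min lexx !orbT.
  have := key (x + s) y l (l * s) ltac:(lra) y01 ltac:(lra)
    ltac:(exact: mulr_gt0).
  have -> : l * (x + s) + (1 - l) * y - l * s = l * x + (1 - l) * y by ring.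
  have ls : l * s <= s by rewrite ler_piMl// ltW.
  have k1 : cdf01 mu (x + s + l * s) <= cdf01 mu x + e.
    by apply: le_trans (cdf01_le mu _) h1; lra.
  have k2 : cdf01 mu (y + l * s) <= cdf01 mu y + e.
    by apply: le_trans (cdf01_le mu _) h2; lra.
  have := ler_wpM2l (ltW l0) k1.
  have := ler_wpM2l (_ : 0 <= 1 - l) k2; rewrite subr_ge0 => /(_ l1); lra.
(* the end point that is moved must be less than 1: take x, or y by symmetry *)
move=> x y l x01 y01 l01; have [x0 x1] := andP x01; have [y0 y1] := andP y01.
have [l0 l1] := andP l01.
have [->|lN0] := eqVneq l 0; first by rewrite !mul0r !add0r subr0 !mul1r.
have [->|lN1] := eqVneq l 1; first by rewrite subrr !mul0r !addr0 !mul1r.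
have lp : 0 < l by rewrite lt_neqAle eq_sym lN0.
have lp' : l < 1 by rewrite lt_neqAle lN1.
have [x1'|x1'] := ltP x 1; first by apply: main => //; rewrite lp.
have [y1'|y1'] := ltP y 1.
  have := @main y x (1 - l) y0 y1' x01 ltac:(lra).
  by rewrite subKr => h; rewrite addrC [leRHS]addrC.
have -> : x = 1 by lra.
have -> : y = 1 by lra.
by rewrite -!mulrDl subrKC !mul1r.
Qed.

End weak_topology.

(** * Closed convex sets of distortions *)

Section distortions_closed_convex.
Context {R : realType}.
Implicit Types (mu nu kappa : meas01 R) (f g phi : R -> R).

Lemma distortionsE : distortions =
  convex_cdf `&` [set mu : meas01 R | \int[mu]_(p in `]0, 1]) (fun=> 1) p = 1].
Proof.
apply/seteqP; split=> mu /=.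
  move=> [_ /convex_function01P cmu mu1]; split => //.
  by rewrite Rintegral_cst//= mul1r mu1.
rewrite Rintegral_cst//= mul1r => -[cmu mu1]; split.
- by move=> p q _ _; exact: cdf01_le.
- exact/convex_function01P.
- have fin : mu `]0, 1]%classic \is a fin_num by rewrite fin_num_measure//;
  exact: measurable_itv.
  by rewrite -(fineK fin) mu1.
Qed.

Lemma closed_distortions : closed (@distortions R).
Proof.
rewrite distortionsE; apply: closedI; first exact: closed_convex_cdf.
apply: closed_pairing_eq; first by move=> p; exact: cvg_cst.
by exists 1 => u _; rewrite normr1.
Qed.

Lemma convex_distortions : convex_meas (@distortions R).
Proof.
move=> mu nu kappa t [_ /convex_function01P cmu mu1]
  [_ /convex_function01P cnu nu1] t01 kE.
have [t0 t1] := andP t01.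
have cdfE p : cdf01 kappa p = t * cdf01 mu p + (1 - t) * cdf01 nu p.
  rewrite /cdf01 kE; last exact: measurable_itv.
  by rewrite fineD ?fineM ?fin_numM ?fin_num_measure.
split.
- by move=> p q _ _; exact: cdf01_le.
- apply/convex_function01P => x y l x01 y01 l01; rewrite !cdfE.
  have := ler_wpM2l t0 (cmu x y l x01 y01 l01).
  have := ler_wpM2l (_ : 0 <= 1 - t) (cnu x y l x01 y01 l01).
  by rewrite subr_ge0 => /(_ t1); lra.
- rewrite kE; last exact: measurable_itv.
  by rewrite mu1 nu1 !mule1 -EFinD addrC subrK.
Qed.

Lemma convex_integral mu nu kappa (t : R) phi : distortions mu ->
  distortions nu ->
  0 <= t <= 1 ->
  (forall A : set (measurableTypeR R), measurable A ->
     kappa A = (t%:E * mu A + (1 - t)%:E * nu A)%E) ->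
  mono01 phi -> level01 phi ->
  \int[kappa]_(p in `]0, 1]) phi p =
  t * \int[mu]_(p in `]0, 1]) phi p + (1 - t) * \int[nu]_(p in `]0, 1]) phi p.
Proof.
move=> dmu dnu t01 kE; have [t0 t1] := andP t01; have t1' : 0 <= 1 - t by lra.
have dk := convex_distortions dmu dnu t01 kE.
have mono xi : distortions xi ->
  mono_functional (fun phi => \int[xi]_(p in `]0, 1]) phi p).
  by case=> _ _; exact: meas01_mono_functional.
have [lmu omu cmu] := mono _ dmu; have [lnu onu cnu] := mono _ dnu.
apply: (@mono_functional_ext _ (fun phi => \int[kappa]_(p in `]0, 1]) phi p)
  (fun phi => t * \int[mu]_(p in `]0, 1]) phi p +
    (1 - t) * \int[nu]_(p in `]0, 1]) phi p)).
- exact: mono.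
- split=> [f g a b mf mg a0 b0|f g mf mg h|c].
  + by rewrite lmu// lnu//; ring.
  + by rewrite lerD// ler_wpM2l// ?omu ?onu.
  + by rewrite cmu cnu -mulrDl addrC subrK mul1r.
move=> q q01; have E (xi : meas01 R) : \int[xi]_(p in `]0, 1]) step q p =
    fine (xi (`]q, +oo[ `&` `]0, 1])).
  by rewrite stepE /Rintegral integral_indic.
have mq : measurable (`]q, +oo[ `&` `]0, 1] : set (measurableTypeR R)).
  by apply: measurableI; exact: measurable_itv.
by rewrite !E kE// fineD ?fineM ?fin_numM ?fin_num_measure.
Qed.

Section lipschitz_envelope.
Variable phi : R -> R.
Hypothesis mphi : mono01 phi.
Hypothesis lphi : level01 phi.

(** The largest [n]-Lipschitz function below [phi] on (0,1]. *)
Definition lip_env (n : nat) (p : R) :=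
  inf [set phi x + n%:R * `|p - x| | x in `]0, 1]%classic].

Let lip_env_lb n p M : (forall u, 0 < u <= 1 -> `|phi u| <= M) ->
  lbound [set phi x + n%:R * `|p - x| | x in `]0, 1]%classic] (- M).
Proof.
move=> hM _ [x /= + <-]; rewrite in_itv/= => /hM;
  rewrite ler_norml => /andP[h _].
by apply: (le_trans h); rewrite lerDl mulr_ge0.
Qed.

Let lip_env_has_inf n p : has_inf
  [set phi x + n%:R * `|p - x| | x in `]0, 1]%classic].
Proof.
split; first by exists (phi 1 + n%:R * `|p - 1|), 1 => //=;
  rewrite in_itv/= ltr01 lexx.
by have [[M hM] _] := mphi; exists (- M); exact: lip_env_lb.
Qed.

Let lip_env_le n p x : 0 < x <= 1 -> lip_env n p <= phi x + n%:R * `|p - x|.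
Proof.
move=> x01; apply: ge_inf; first by case: (lip_env_has_inf n p).
by exists x.
Qed.

Lemma lip_env_below n p : 0 < p <= 1 -> lip_env n p <= phi p.
Proof. by move=> /(lip_env_le n p); rewrite subrr normr0 mulr0 addr0. Qed.

Let lip_env_lip n p q : lip_env n p <= lip_env n q + n%:R * `|p - q|.
Proof.
rewrite -lerBlDr; apply: lb_le_inf; first by case: (lip_env_has_inf n q).
move=> _ [x /= + <-]; rewrite in_itv/= => /(lip_env_le n p) h.
rewrite lerBlDr; apply: (le_trans h); rewrite -addrA lerD2l -mulrDr ler_wpM2l//.
by rewrite [leRHS]addrC; exact: ler_distD.
Qed.

Lemma continuous_lip_env n : continuous (lip_env n).
Proof.
move=> p; apply/cvgrPdist_lt => e e0; near=> q.
have pq : `|p - q| < e / n.+1%:R.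
  by near: q; apply: cvgr_dist_lt; rewrite ?divr_gt0.
have h : n%:R * `|p - q| < e.
  apply: (@le_lt_trans _ _ (n.+1%:R * `|p - q|));
    first by rewrite ler_wpM2r// ler_nat.
  by rewrite mulrC -ltr_pdivlMr.
have := lip_env_lip n p q; have := lip_env_lip n q p; rewrite (distrC q).
by rewrite ltr_norml => ? ?; apply/andP; split; lra.
Unshelve. all: by end_near. Qed.

Lemma bounded01_lip_env n : bounded01 (lip_env n).
Proof.
have [[M hM] _] := mphi; exists M => p p01; rewrite ler_norml; apply/andP;
  split.
  by apply: lb_le_inf; [case: (lip_env_has_inf n p)|exact: lip_env_lb].
apply: le_trans (lip_env_below n p01) _.
by have := hM p p01; rewrite ler_norml => /andP[].
Qed.

Lemma cvg_lip_env p : 0 < p <= 1 -> lip_env n p @[n --> \oo] --> phi p.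
Proof.
move=> p01; have [[M hM] _] := mphi.
apply/cvgrPdist_le => e e0.
have [q q01 hq] := lphi (phi p - e).
have qp : q < p by rewrite -hq// gtrBl.
near=> n.
have nM : (M + M) / (p - q) <= n%:R by near: n; exact: nbhs_infty_ger.
have := lip_env_below n p01 => h1.
suff h2 : phi p - e <= lip_env n p by rewrite ler_norml; apply/andP; split; lra.
apply: lb_le_inf; first by case: (lip_env_has_inf n p).
move=> _ [x /= + <-]; rewrite in_itv/= => x01.
have [qx|xq] := ltP q x.
  apply: (@le_trans _ _ (phi x)); last by rewrite lerDl mulr_ge0.
  by apply: ltW; rewrite hq.
have : M + M <= n%:R * `|p - x|.
  rewrite ler_pdivrMr ?subr_gt0// in nM; apply: (le_trans nM).
  by rewrite ler_wpM2l// (le_trans _ (ler_norm _))// lerD2l lerN2.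
have := hM x x01; have := hM p p01; rewrite !ler_norml => /andP[? ?] /andP[? ?];
  lra.
Unshelve. all: by end_near. Qed.

(** The envelopes lie below [phi] and converge to it, by left-continuity; hence
    the integral of [phi] is the supremum of weakly continuous functions. *)
Lemma closed_integral_le (c : R) :
  closed [set nu : meas01 R | \int[nu]_(p in `]0, 1]) phi p <= c].
Proof.
have -> : [set nu : meas01 R | \int[nu]_(p in `]0, 1]) phi p <= c] =
  \bigcap_n [set nu : meas01 R | \int[nu]_(p in `]0, 1]) lip_env n p <= c].
  have il n (nu : meas01 R) : nu.-integrable `]0, 1] (EFin \o lip_env n).
    by apply: integrable_continuous01;
      [exact: continuous_lip_env|exact: bounded01_lip_env].
  apply/seteqP; split=> nu /=.
    move=> h n _; apply: le_trans h;
      apply: (le_Rintegral _ (il n nu) (integrable_meas01 nu mphi)) => //.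
    by move=> p /=; rewrite in_itv/=; exact: lip_env_below.
  move=> h; have [[M hM] _] := mphi.
  have mp : measurable_fun (`]0%R, 1%R]%classic : set (measurableTypeR R))
    (EFin \o phi).
    by apply/measurable_EFinP; exact: measurable_mono01.
  have iE n : (\int[nu]_(p in `]0%R, 1%R]) (EFin \o lip_env n) p <= c%:E)%E.
    have fin : (\int[nu]_(p in `]0%R, 1%R]) (EFin \o lip_env n) p)%E \is a
      fin_num.
      exact: integrable_fin_num (il n nu).
    by rewrite -(fineK fin) lee_fin; exact: h.
  have fin : (\int[nu]_(p in `]0%R, 1%R]) (EFin \o phi) p)%E \is a fin_num.
    exact: integrable_fin_num (integrable_meas01 nu mphi).
  rewrite -lee_fin /Rintegral (fineK fin).
  have [||||_ _ cv] := @dominated_convergence _ _ _ nu `]0, 1]%classic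
    (measurable_itv _) (fun n => EFin \o lip_env n) (EFin \o phi) (fun=> M%:E) _
      mp.
  - by move=> n; have /integrableP[] := il n nu.
  - apply: aeW => p; rewrite /= in_itv/= => p01.
    by apply: cvg_EFin; [apply: nearW|exact: cvg_lip_env].
  - exact: integrable_meas01 (mono01_cst M).
  - apply: aeW => p n; rewrite /= in_itv/= => p01; rewrite lee_fin ler_norml.
    have [h1 h2] : - M <= lip_env n p /\ lip_env n p <= phi p.
      split; last exact: lip_env_below.
      by apply: lb_le_inf; [case: (lip_env_has_inf n p)|exact: lip_env_lb].
    by have := hM p p01; rewrite h1 /= ler_norml => /andP[_]; exact: le_trans.
  rewrite -(cvg_lim _ cv)//; apply: lime_le; first by apply/cvg_ex; eexists;
    exact: cv.
  exact: nearW.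
by apply: closed_bigI => n _; apply: closed_pairing_le;
  [exact: continuous_lip_env|exact: bounded01_lip_env].
Qed.
End lipschitz_envelope.

End distortions_closed_convex.

(** * Duality *)

Section conjugate_duality.
Context {R : realType} {X : ptopologicalType}.
Implicit Types (Z V : X -> R) (P : prob X R) (mu : meas01 R).
Implicit Types (rho : (X -> R) -> prob X R -> R).

Lemma mono01_quantile Z P : bmeas R X Z -> mono01 (quantile Z P).
Proof.
move=> bZ; have [_ /bounded_fun_exP[M ZM]] := bZ; split.
  by exists M => u u01; exact: quantile_norm_le.
by move=> u v; exact: quantile_homo.
Qed.

Lemma level01_quantile Z P : bmeas R X Z -> level01 (quantile Z P).
Proof. by move=> bZ; exact: quantile_gt. Qed.

Lemma quantile_integralE Z P mu : bmeas R X Z ->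
  quantile_integral Z P mu = (\int[mu]_(p in `]0, 1]) quantile Z P p)%:E.
Proof.
move=> bZ; rewrite /Rintegral fineK//.
exact: integrable_fin_num (integrable_meas01 mu (mono01_quantile P bZ)).
Qed.

Lemma bmeas0 : bmeas R X (fun=> 0).
Proof.
split; first exact: measurable_cst.
by apply/bounded_fun_exP; exists 0 => x; rewrite normr0.
Qed.

Lemma conj_form_le rho mu (c : R) :
  (conj_form rho mu <= c%:E)%E <->
  forall Z P, bmeas R X Z ->
    \int[mu]_(p in `]0, 1]) quantile Z P p - rho Z P <= c.
Proof.
split=> [h Z P bZ|h].
  rewrite -lee_fin; apply: le_trans h; apply: ereal_sup_ubound.
  by exists (Z, P) => //=; rewrite quantile_integralE.
apply: ge_ereal_sup => _ [[Z P] [/= bZ _] <-].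
by rewrite quantile_integralE// -EFinB lee_fin h.
Qed.

Lemma conj_form_ge rho mu Z P : bmeas R X Z ->
  ((\int[mu]_(p in `]0, 1]) quantile Z P p - rho Z P)%:E <= conj_form rho mu)%E.
Proof.
move=> bZ; apply: ereal_sup_ubound.
by exists (Z, P) => //=; rewrite quantile_integralE.
Qed.

Lemma conj_form_ge0 rho mu P : normalized rho -> (0 <= conj_form rho mu)%E.
Proof.
move=> hn; have := conj_form_ge rho mu P bmeas0; rewrite hn subr0.
rewrite (@eq_Rintegral _ _ _ _ _ (fun=> 0));
  first by rewrite Rintegral_cst// mul0r.
move=> p; rewrite inE/= in_itv/= => p01; apply/eqP; rewrite -normr_le0.
by apply: quantile_norm_le => //; [exact: bmeas0|move=> x; rewrite normr0].
Qed.

(** Scaling [Z] scales the expression under the supremum, which can only stay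
    bounded if it is at most 0. *)
Lemma conj_form_homogeneous rho mu : positively_homogeneous rho ->
  (conj_form rho mu < +oo)%E -> (conj_form rho mu <= 0)%E.
Proof.
move=> hph fin.
have [c hc] : exists c : R, (conj_form rho mu <= c%:E)%E.
  move: fin; case: conj_form => [c _|//|_]; first by exists c.
  by exists 0; rewrite leNye.
apply/conj_form_le => Z P bZ; rewrite leNgt; apply/negP => x0.
move: x0; set x := (X in 0 < X) => x0.
have c0 : 0 < `|c| + 1 by rewrite ltr_wpDl.
pose b := (`|c| + 1) / x.
have b0 : 0 < b by rewrite divr_gt0.
have bbZ : bmeas R X (fun t => b * Z t).
  have [mZ /bounded_fun_exP[M ZM]] := bZ.
  split; first by apply: measurable_funM => //; exact: measurable_cst.
  apply/bounded_fun_exP; exists (b * M) => t.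
  by rewrite normrM (gtr0_norm b0) ler_pM2l.
have /conj_form_le/(_ _ P bbZ) := hc.
rewrite hph ?(ltW b0)//.
have -> : \int[mu]_(p in `]0, 1]) quantile (fun t => b * Z t) P p =
    b * \int[mu]_(p in `]0, 1]) quantile Z P p.
  rewrite -RintegralZl//; last exact: integrable_meas01 (mono01_quantile P bZ).
  by apply: eq_Rintegral => p; rewrite inE/= in_itv/= => p01;
    rewrite quantile_scale.
rewrite -mulrBr -/x /b divfK ?gt_eqF// => h.
by have := ler_norm c; lra.
Qed.

(** The distortions at which the conjugate is at most 0. *)
Definition conj_null rho : set (meas01 R) :=
  distortions `&` [set mu | (conj_form rho mu <= 0)%E].

Lemma closed_conj_null rho : closed (conj_null rho).
Proof.
apply: closedI; first exact: closed_distortions.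
have -> : [set mu | (conj_form rho mu <= 0)%E] =
  \bigcap_(ZP in bmeas R X `*` setT)
    [set mu : meas01 R | \int[mu]_(p in `]0, 1]) quantile ZP.1 ZP.2 p <=
      rho ZP.1 ZP.2].
  apply/seteqP; split=> mu /=.
    by move=> /conj_form_le h [Z P] [/= bZ _]; have := h Z P bZ;
      rewrite subr_le0.
  move=> h; apply/conj_form_le => Z P bZ; rewrite subr_le0.
  exact: (h (Z, P)).
apply: closed_bigI => -[Z P] [/= bZ _].
by apply: closed_integral_le; [exact: mono01_quantile|exact: level01_quantile].
Qed.

Lemma convex_conj_null rho : convex_meas (conj_null rho).
Proof.
move=> mu nu kappa t [dmu /conj_form_le hmu] [dnu /conj_form_le hnu] t01 kE.
split; first exact: convex_distortions dmu dnu t01 kE.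
apply/conj_form_le => Z P bZ; have [t0 t1] := andP t01.
rewrite (convex_integral dmu dnu t01 kE (mono01_quantile P bZ)
  (level01_quantile P bZ)).
have := ler_wpM2l t0 (hmu Z P bZ);
  have := ler_wpM2l (_ : 0 <= 1 - t) (hnu Z P bZ).
by rewrite subr_ge0 => /(_ t1); lra.
Qed.

End conjugate_duality.

Section supporting_distortion.
Context {R : realType} {X : ptopologicalType}.
Variables (Q : prob X R) (U : borel X -> R).
Hypothesis mU : measurable_fun [set: borel X] U.
Hypothesis U01 : forall x, 0 < U x <= 1.
Hypothesis QU : forall f : R -> \bar R, measurable_fun [set: R] f ->
  (forall x, 0 <= f x)%E ->
  (\int[Q]_x f (U x) = \int[lebesgue_measure]_(u in `]0%R, 1%R]) f u)%E.

Lemma bmeas_comp (phi : R -> R) : mono01 phi -> bmeas R X (phi \o U).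
Proof.
move=> mphi; split.
  apply: (@measurable_comp _ _ _ _ _ _ (`]0%R, 1%R]%classic : set R)) => //.
    by move=> _ [x _ <-] /=; rewrite in_itv/=.
  exact: measurable_mono01.
by have [[M hM] _] := mphi; apply/bounded_fun_exP; exists M => x; exact: hM.
Qed.

Lemma icx_comp (phi psi : R -> R) : mono01 phi -> mono01 psi ->
  (forall a, 0 <= a <= 1 -> tail_int phi a <= tail_int psi a) ->
  icx (phi \o U) Q (psi \o U) Q.
Proof.
move=> mphi mpsi h eta.
have E xi : mono01 xi -> (\int[Q]_x (Num.max 0 ((xi \o U) x - eta))%:E)%E =
    (\int[lebesgue_measure]_(u in `]0, 1]) Num.max 0 (xi u - eta))%:E.
  move=> mxi.
  have mpos : mono01 (fun u => Num.max 0 (xi u - eta)).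
    exact: mono01_pospart.
  pose f u := ((fun u => Num.max 0 (xi u - eta)) \_
    (`]0%R, 1%R]%classic : set R)) u.
  have fE u : 0 < u <= 1 -> f u = Num.max 0 (xi u - eta).
    by move=> u01; rewrite /f patchE mem_set//= in_itv.
  have mf : measurable_fun setT (EFin \o f).
    apply/measurable_EFinP/(measurable_restrictT _ _).1 => //.
    exact: measurable_mono01.
  have f0 u : (0 <= (EFin \o f) u)%E.
    by rewrite lee_fin /f patchE; case: ifP => // _; rewrite le_max lexx.
  have := QU mf f0.
  rewrite (eq_integral (fun x => (Num.max 0 ((xi \o U) x - eta))%:E));
    last first.
    by move=> x _; rewrite /= fE.
  move=> ->; rewrite /Rintegral fineK; last first.
    exact: integrable_fin_num (integrable_mono01 mpos (lexx 0) (lexx 1)).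
  by apply: eq_integral => u; rewrite inE/= in_itv/= => u01; rewrite /= fE.
by rewrite !E// lee_fin; exact: le_integral_pospart.
Qed.

(** [quantile Z P \o U] has the same law under [Q] as [Z] under [P]. *)
Lemma cdf_comp_quantile (Z : X -> R) (P : prob X R) (eta : R) : bmeas R X Z ->
  P [set x | (Z x <= eta)%R] = Q [set x | ((quantile Z P \o U) x <= eta)%R].
Proof.
move=> bZ; set q := P [set x | (Z x <= eta)%R].
have fq : q \is a fin_num by rewrite fin_num_measure//; exact: bmeas_setle.
have q0 : 0 <= fine q by rewrite fine_ge0// measure_ge0.
have q1 : fine q <= 1.
  by rewrite -lee_fin fineK//; apply: probability_le1; exact: bmeas_setle.
have -> : [set x | ((quantile Z P \o U) x <= eta)%R] = U @^-1` `]-oo, fine q].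
  apply/seteqP; split=> x /=; rewrite in_itv/= quantile_le// -/q.
    by rewrite -(fineK fq) lee_fin.
  by rewrite -(fineK fq) lee_fin.
have mI : measurable (U @^-1` `]-oo, fine q]).
  by rewrite -[X in measurable X]setTI; exact: mU.
have -> : Q (U @^-1` `]-oo, fine q]) =
  (\int[Q]_x (\1_(`]-oo, fine q]) (U x))%:E)%E.
  transitivity (\int[Q]_x (\1_(U @^-1` `]-oo, fine q]) x)%:E)%E => //.
  by rewrite integral_indic// setIT.
rewrite [RHS](QU (f := fun u => (\1_(`]-oo, fine q]) u)%:E)); last 2 first.
- by apply/measurable_EFinP; exact: measurable_indic.
- by move=> u; rewrite lee_fin indicE.
rewrite integral_indic//.
have -> : `]-oo, fine q] `&` `]0, 1] = `]0, fine q]%classic :> set R.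
  by apply/seteqP; split=> u /=; rewrite !in_itv/=; lra.
rewrite [RHS]lebesgue_measure_itv/= lte_fin; case: ltP => [_|q0'].
  by rewrite oppr0 adde0 fineK.
by rewrite -[LHS](fineK fq); congr EFin; apply/eqP; rewrite eq_le q0 q0'.
Qed.

Variable rho : (X -> R) -> prob X R -> R.
Hypothesis htrans : translation_equivariant rho.
Hypothesis hconv : comonotonically_convex rho.
Hypothesis hicx : icx_consistent rho.

(** [rho] is a function of the quantile function. *)
Lemma rho_quantile (Z : X -> R) (P : prob X R) : bmeas R X Z ->
  rho Z P = rho (quantile Z P \o U) Q.
Proof.
move=> bZ; have bq := bmeas_comp (mono01_quantile P bZ).
apply/eqP; rewrite eq_le; apply/andP; split; apply: hicx => //.
  by apply: icx_of_cdf => // eta; exact: cdf_comp_quantile.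
by apply: icx_of_cdf => // eta; exact/esym/cdf_comp_quantile.
Qed.

Lemma comonotonic_comp (phi psi : R -> R) : mono01 phi -> mono01 psi ->
  comonotonic (phi \o U : X -> R) (psi \o U).
Proof.
move=> [_ mphi] [_ mpsi] x y /=.
have /andP[x0 x1] := U01 x; have /andP[y0 y1] := U01 y.
have [xy|/ltW yx] := leP (U x) (U y).
  by rewrite mulr_ge0// subr_ge0 ?mphi ?mpsi.
by rewrite mulr_le0// subr_le0 ?mphi ?mpsi.
Qed.

(** The supremum in the representation is attained on the domain of the
    conjugate. *)
Lemma supporting_distortion (Z : X -> R) (P : prob X R) : bmeas R X Z ->
  exists2 mu, conj_domain rho mu &
    ((rho Z P)%:E <= quantile_integral Z P mu - conj_form rho mu)%E.
Proof.
move=> bZ; have mq := mono01_quantile P bZ.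
have [|||L HL hL] := @supporting_functional R (fun phi => rho (phi \o U) Q) _ _
  _ _ mq.
- move=> phi psi mphi mpsi h; apply: hicx;
  [exact: bmeas_comp|exact: bmeas_comp|].
  exact: icx_comp.
- by move=> phi c mphi; rewrite -htrans//; exact: bmeas_comp.
- move=> phi psi l mphi mpsi l01; apply: hconv => //.
  + exact: bmeas_comp.
  + exact: bmeas_comp.
  + exact: comonotonic_comp.
have [mu dmu muE] := measure_of_tail_functional HL.
pose k := \int[mu]_(p in `]0, 1]) quantile Z P p - rho Z P.
have kc : (conj_form rho mu <= k%:E)%E.
  apply/conj_form_le => Z' P' bZ'.
  have := hL _ (mono01_quantile P' bZ').
  rewrite (muE _ (mono01_quantile P' bZ') (level01_quantile P' bZ')).
  rewrite (muE _ mq (level01_quantile P bZ)) -!rho_quantile// /k; lra.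
exists mu; first by split => //; exact: le_lt_trans kc (ltry _).
rewrite quantile_integralE//.
apply: (@le_trans _ _ ((\int[mu]_(p in `]0, 1]) quantile Z P p)%:E - k%:E)%E).
  by rewrite -EFinB lee_fin /k; lra.
by rewrite leeB.
Qed.

End supporting_distortion.

Theorem theorem3p1 (R : realType) (X : ptopologicalType)
    (hX : polish R X) (hXunc : ~ countable [set: X])
    (F : set_system ((X -> R) * prob X R))
    (hF : sigma_algebra (bmeas R X `*` setT) F)
    (rho : (X -> R) -> prob X R -> R)
    (hmeas : measurable_form F rho)
    (hnorm : normalized rho)
    (htrans : translation_equivariant rho)
    (hconv : comonotonically_convex rho)
    (hicx : icx_consistent rho) :
  exists! D : set (meas01 R),
    [/\ closed D, convex_meas D, D `<=` distortions, represents rho D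
      & least_closed_convex (conj_domain rho) D] /\
    (positively_homogeneous rho ->
       forall mu : meas01 R, D mu -> conj_form rho mu = 0%E).
Proof.
have [Q [U [mU U01 QU]]] := polish_uniform hX hXunc.
pose D := \bigcap_(C in [set C : set (meas01 R) |
  [/\ closed C, convex_meas C & conj_domain rho `<=` C]]) C.
have Dmin C : closed C -> convex_meas C -> conj_domain rho `<=` C -> D `<=` C.
  by move=> cC vC dC mu; apply.
have Ddom : conj_domain rho `<=` D by move=> mu dmu C [_ _]; apply.
have cD : closed D by apply: closed_bigI => C [].
have vD : convex_meas D.
  move=> mu nu kappa t Dmu Dnu t01 kE C hC; have [_ vC _] := hC.
  exact: (vC mu nu kappa t (Dmu C hC) (Dnu C hC) t01 kE).
exists D; split; last first.
  move=> D' [[cD' vD' _ _ [dD' minD']] _]; apply/seteqP; split.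
    exact: Dmin.
  exact: minD'.
split; last first.
  move=> hph mu Dmu; apply/eqP; rewrite eq_le (conj_form_ge0 mu Q hnorm) andbT.
  suff : conj_domain rho `<=` conj_null rho.
    move=> /(Dmin _ (@closed_conj_null _ _ rho) (@convex_conj_null _ _ rho)).
    by case/(_ mu Dmu).
  by move=> nu [dnu fnu]; split => //; exact: conj_form_homogeneous.
split => //.
- apply: Dmin; first exact: closed_distortions.
    exact: convex_distortions.
  by move=> mu [].
- move=> Z P bZ; apply/eqP; rewrite eq_le; apply/andP; split.
    have [mu dmu h] := supporting_distortion mU U01 QU htrans hconv hicx P bZ.
    apply: le_trans h _; apply: ereal_sup_ubound.
    by exists mu => //; exact: Ddom.
  apply: ge_ereal_sup => _ [mu _ <-].
  have := conj_form_ge rho mu P bZ; rewrite quantile_integralE//.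
  case: (conj_form rho mu) => [c| |]; last by rewrite leeNy_eq.
    by rewrite -EFinB !lee_fin; lra.
  by rewrite addeNy leNye.
Qed.
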